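(* Let $J$ be the functional $$J(y)=\int_a^b L\big(x,y(x),{}_a^{C}D_x^\alpha y(x),{}_aI_x^\beta y(x),z(x), y(x-\tau), y'(x-\tau)\big)\,dx,\qquad z(x)=\int_a^x l\big(t,y(t),{}_a^{C}D_t^\alpha y(t),{}_aI_t^\beta y(t)\big)\,dt,$$ where $\alpha\in(0,1)$, $\beta>0$, $0<\tau<b-a$, and $L=L(x,y,v,w,z,y_\tau,v_\tau)$ and $l=l(x,y,v,w)$ are of class $C^1$, considered on the set of admissible functions $y$ (described in the context). If $y$ is a minimizer or maximizer of $J$ among the admissible functions, then $y$ is a solution of the following system of equations: 1. $\displaystyle \frac{\partial L}{\partial v_\tau}[y](b)=0$; 2. for every $x\in[a,b-\tau]$, $$\begin{aligned} &\frac{\partial L}{\partial y}[y](x)+{}_xD^\alpha_{b-\tau}\left( \frac{\partial L}{\partial v}[y](x) \right) - \frac{1}{\Gamma(1-\alpha)}\, \frac{d}{dx}\left( \int_{b-\tau}^b(t-x)^{-\alpha} \frac{\partial L}{\partial v}[y](t)\,dt\right)\\ &\quad +{}_xI_{b-\tau}^\beta\left(\frac{\partial L}{\partial w}[y](x)\right) +\frac{1}{\Gamma(\beta)} \int_{b-\tau}^b (t-x)^{\beta-1} \frac{\partial L}{\partial w}[y](t)\,dt +\left(\int_x^b \frac{\partial L}{\partial z}[y](t)\,dt\right) \frac{\partial l}{\partial y}\{y\}(x)\\ &\quad+{}_xD^\alpha_{b-\tau}\left( \left(\int_x^b \frac{\partial L}{\partial z}[y](t)\,dt\right) \frac{\partial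 l}{\partial v}\{y\}(x)\right) -\frac{1}{\Gamma(1-\alpha)} \frac{d}{dx} \left( \int_{b-\tau}^b(t-x)^{-\alpha}\left(\int_t^b \frac{\partial L}{\partial z}[y](k)\,dk\right) \frac{\partial l}{\partial v}\{y\}(t)\,dt \right)\\ &\quad +{}_xI^\beta_{b-\tau}\left( \left(\int_x^b \frac{\partial L}{\partial z}[y](t)\,dt\right) \frac{\partial l}{\partial w}\{y\}(x) \right) +\frac{1}{\Gamma(\beta)} \int_{b-\tau}^b (t-x)^{\beta-1}\left(\int_t^b \frac{\partial L}{\partial z}[y](k)\,dk\right) \frac{\partial l}{\partial w}\{y\}(t)\,dt\\ & \quad +\frac{\partial L}{\partial y_\tau}[y](x+\tau) -\frac{d}{dx}\left(\frac{\partial L}{\partial v_\tau}[y](x+\tau)\right)=0; \end{aligned}$$ 3. for every $x\in[b-\tau,b]$, $$\begin{aligned} &\frac{\partial L}{\partial y}[y](x)+{}_xD^\alpha_b\left( \frac{\partial L}{\partial v}[y](x) \right)+{}_xI_b^\beta\left(\frac{\partial L}{\partial w}[y](x)\right) +\left(\int_x^b \frac{\partial L}{\partial z}[y](t)\,dt\right) \frac{\partial l}{\partial y}\{y\}(x)\\ &\quad+{}_xD^\alpha_b\left( \left(\int_x^b \frac{\partial L}{\partial z}[y](t)\,dt\right) \frac{\partial l}{\partial v}\{y\}(x)\right) +{}_xI^\beta_b\left( \left(\int_x^b \frac{\partial L}{\partial z}[y](t)\,dt\right) \frac{\partial l}{\partial w}\{y\}(x) \right)=0. \end{aligned}$$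
   Context: Fractional operators, for $\alpha\in(0,1)$, $\beta>0$ and endpoints $a$, $c$ (with $c=b$ or $c=b-\tau$): $${}_aI_x^\beta f(x)=\frac{1}{\Gamma(\beta)}\int_a^x (x-t)^{\beta-1}f(t)\,dt,\qquad {}_xI_c^\beta f(x)=\frac{1}{\Gamma(\beta)}\int_x^c(t-x)^{\beta-1} f(t)\,dt$$ (left and right fractional integrals), $${}_xD_c^\alpha f(x)=\frac{-1}{\Gamma(1-\alpha)}\frac{d}{dx}\int_x^c (t-x)^{-\alpha} f(t)\,dt$$ (right Riemann--Liouville derivative), and $${}_a^{C}D_x^\alpha f(x)=\frac{1}{\Gamma(1-\alpha)}\int_a^x (x-t)^{-\alpha}f'(t)\,dt$$ (left Caputo derivative). An expression such as ${}_xD^\alpha_c(F(x))$ or ${}_xI^\beta_c(F(x))$ means the operator applied to the function $x\mapsto F(x)$, evaluated at $x$. Admissible functions: those $y\in C^1[a-\tau,b]$ such that ${}_a^{C}D_x^\alpha y(x)$ and ${}_aI_x^\beta y(x)$ exist and are continuous on $[a,b]$, $y(b)=y_b$ for a fixed $y_b\in\mathbb{R}$, and $y(x)=\phi(x)$ for all $x\in[a-\tau,a]$, where $\phi$ is a fixed function. Notation: $[y](x)=\big(x,y(x),{}_a^{C}D_x^\alpha y(x),{}_aI_x^\beta y(x),z(x),y(x-\tau),y'(x-\tau)\big)$ and $\{y\}(x)=\big(x,y(x),{}_a^{C}D_x^\alpha y(x),{}_aI_x^\beta y(x)\big)$. The partial derivatives of $L$ and $l$ are with respect to their arguments, named as $L(x,y,v,w,z,y_\tau,v_\tau)$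 and $l(x,y,v,w)$; $\frac{\partial L}{\partial v}[y](x)$ denotes the partial derivative evaluated at the point $[y](x)$, $\frac{\partial l}{\partial v}\{y\}(x)$ the one evaluated at $\{y\}(x)$, and similarly for the other variables; $[y](x+\tau)$ is $[y]$ evaluated at $x+\tau$.
   Formalization: Equations 2 and 3 are asserted at each x where every derivative d/dx displayed in them exists (one-sided at interval endpoints); as written, the separate terms can fail to exist, e.g. at x = b−τ when ∂L/∂v[y](b−τ) ≠ 0. *)

(* Defs.v *)
From HB Require Import structures.
From mathcomp Require Import all_boot all_order all_algebra.
From mathcomp Require Import all_classical all_reals all_analysis.

Set Implicit Arguments.
Unset Strict Implicit.
Unset Printing Implicit Defensive.

Import Order.TTheory GRing.Theory Num.Theory.
Import numFieldNormedType.Exports.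

Local Open Scope classical_set_scope.
Local Open Scope ring_scope.

Definition Gamma (R : realType) (s : R) : R :=
  \int[@lebesgue_measure R]_(t in `]0, +oo[) (t `^ (s - 1) * expR (- t)).

(* Derivative at x of F as a function on S: the increments stay in S, so that
   it is one-sided at an endpoint of an interval S. [deriv_on] is meaningful
   only where [derivable_on] holds. *)
Definition diff_quot (R : realType) (F : R -> R) (x : R) : R -> R :=
  fun u => (F u - F x) / (u - x).

Definition derivable_on (R : realType) (S : set R) (F : R -> R) (x : R) : Prop :=
  cvg (diff_quot F x @ within S x^').

Definition deriv_on (R : realType) (S : set R) (F : R -> R) (x : R) : R :=
  lim (diff_quot F x @ within S x^').

Definition C1_fun (R : realType) (S : set R) (f : R -> R) : Prop :=
  (forall x, S x -> derivable_on S f x) /\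
  {within S, continuous (deriv_on S f)}.

Definition set_coord (R : realType) (n : nat) (p : 'rV[R]_n) (i : 'I_n) (u : R)
    : 'rV[R]_n :=
  \row_j (if j == i then u else p 0 j).

Definition coord_slice (R : realType) (n : nat) (D : set 'rV[R]_n) (i : 'I_n)
    (p : 'rV[R]_n) : set R :=
  [set u | D (set_coord p i u)].

Definition has_partial (R : realType) (n : nat) (D : set 'rV[R]_n) (i : 'I_n)
    (f : 'rV[R]_n -> R) (p : 'rV[R]_n) : Prop :=
  derivable_on (coord_slice D i p) (fun u => f (set_coord p i u)) (p 0 i).

Definition partial (R : realType) (n : nat) (D : set 'rV[R]_n) (i : 'I_n)
    (f : 'rV[R]_n -> R) (p : 'rV[R]_n) : R :=
  deriv_on (coord_slice D i p) (fun u => f (set_coord p i u)) (p 0 i).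

Definition C1_on (R : realType) (n : nat) (D : set 'rV[R]_n)
    (f : 'rV[R]_n -> R) : Prop :=
  {within D, continuous f} /\
  forall i : 'I_n, (forall p, D p -> has_partial D i f p) /\
                   {within D, continuous (partial D i f)}.

(* [a, b] x R^n, the domain of the Lagrangians. *)
Definition slab (R : realType) (n : nat) (a b : R) : set 'rV[R]_n.+1 :=
  [set p | a <= p 0 0 <= b].

(* Positions of the named arguments in L(x, y, v, w, z, y_tau, v_tau) and,
   for the first ones, in l(x, y, v, w). *)
Definition arg_y (n : nat) : 'I_n.+4 := @Ordinal n.+4 1 isT.
Definition arg_v (n : nat) : 'I_n.+4 := @Ordinal n.+4 2 isT.
Definition arg_w (n : nat) : 'I_n.+4 := @Ordinal n.+4 3 isT.
Definition arg_z : 'I_7 := @Ordinal 7 4 isT.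
Definition arg_ytau : 'I_7 := @Ordinal 7 5 isT.
Definition arg_vtau : 'I_7 := @Ordinal 7 6 isT.
Arguments arg_y {n}.
Arguments arg_v {n}.
Arguments arg_w {n}.

Definition left_integrand (R : realType) (s x : R) (f : R -> R) : R -> R :=
  fun t => (x - t) `^ s * f t.

Definition left_frac_int (R : realType) (beta a : R) (f : R -> R) (x : R) : R :=
  (Gamma beta)^-1 *
  \int[@lebesgue_measure R]_(t in `[a, x]) left_integrand (beta - 1) x f t.

(* derive1 f is a two-sided derivative; a possible failure at the endpoints of
   [a, x] does not affect the integral. *)
Definition caputo (R : realType) (alpha a : R) (f : R -> R) (x : R) : R :=
  (Gamma (1 - alpha))^-1 *
  \int[@lebesgue_measure R]_(t in `[a, x]) left_integrand (- alpha) x (derive1 f) t.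

Definition right_kernel_int (R : realType) (s p q : R) (f : R -> R) (x : R) : R :=
  \int[@lebesgue_measure R]_(t in `[p, q]) ((t - x) `^ s * f t).

Definition right_frac_int (R : realType) (beta c : R) (f : R -> R) (x : R) : R :=
  (Gamma beta)^-1 * right_kernel_int (beta - 1) x c f x.

(* Right Riemann-Liouville derivative, d/dx being taken on S. *)
Definition right_RL_derivable (R : realType) (S : set R) (alpha c : R)
    (f : R -> R) (x : R) : Prop :=
  derivable_on S (fun u => right_kernel_int (- alpha) u c f u) x.

Definition right_RL (R : realType) (S : set R) (alpha c : R)
    (f : R -> R) (x : R) : R :=
  - (Gamma (1 - alpha))^-1 *
  deriv_on S (fun u => right_kernel_int (- alpha) u c f u) x.

Definition admissible (R : realType) (alpha beta tau a b : R) (phi : R -> R)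
    (yb : R) (y : R -> R) : Prop :=
  [/\ C1_fun `[a - tau, b] y,
      (forall x, a <= x <= b ->
         (@lebesgue_measure R).-integrable `[a, x]
           (EFin \o left_integrand (- alpha) x (derive1 y))) /\
      {within `[a, b], continuous (caputo alpha a y)},
      (forall x, a <= x <= b ->
         (@lebesgue_measure R).-integrable `[a, x]
           (EFin \o left_integrand (beta - 1) x y)) /\
      {within `[a, b], continuous (left_frac_int beta a y)},
      y b = yb
    & forall x, a - tau <= x <= a -> y x = phi x].

(* {y}(x) *)
Definition curly (R : realType) (alpha beta a : R) (y : R -> R) (x : R)
    : 'rV[R]_4 :=
  \row_(i < 4) [:: x; y x; caputo alpha a y x; left_frac_int beta a y x]`_i.

Definition zfun (R : realType) (alpha beta a : R) (l : 'rV[R]_4 -> R)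
    (y : R -> R) (x : R) : R :=
  \int[@lebesgue_measure R]_(t in `[a, x]) l (curly alpha beta a y t).

(* [y](x); the derivative of y is the one on its domain [a - tau, b]. *)
Definition bracket (R : realType) (alpha beta tau a b : R) (l : 'rV[R]_4 -> R)
    (y : R -> R) (x : R) : 'rV[R]_7 :=
  \row_(i < 7) [:: x; y x; caputo alpha a y x; left_frac_int beta a y x;
                   zfun alpha beta a l y x; y (x - tau);
                   deriv_on `[a - tau, b] y (x - tau)]`_i.

Definition J (R : realType) (alpha beta tau a b : R) (L : 'rV[R]_7 -> R)
    (l : 'rV[R]_4 -> R) (y : R -> R) : R :=
  \int[@lebesgue_measure R]_(x in `[a, b]) L (bracket alpha beta tau a b l y x).

(* Main.v *)
Require Import Defs.
From HB Require Import structures.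
From mathcomp Require Import all_boot all_order all_algebra.
From mathcomp Require Import all_classical all_reals all_analysis.
From mathcomp Require Import measurable_realfun ring lra.

Set Implicit Arguments.
Unset Strict Implicit.
Unset Printing Implicit Defensive.

Import Order.TTheory GRing.Theory Num.Theory.
Import numFieldNormedType.Exports.

Local Open Scope classical_set_scope.
Local Open Scope ring_scope.

(* Perturb y by eps * h, where h is the primitive vanishing at a of a continuous
   function eta which is 0 to the left of a and has integral 0 over [a, b]. As L and l are
   C^1 and the curves {y}, [y] are compact, J (y + eps * h) has a first-order expansion
   in eps, first through z and then through L, whose coefficient must vanish.
   Fubini's theorem moves every kernel off h and eta and turns this condition into
     \int_a^b eta * B + \int_a^(b - tau) eta * E = 0
   for all such eta, where B and E contain no derivative of dL/dv, dl/dv or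
   dL/dv_tau. By du Bois-Reymond, B + E is constant on [a, b - tau] and B is the same
   constant on [b - tau, b]. At b - tau this gives dL/dv_tau [y](b) = 0, since
   E (b - tau) is that value; differentiating the two constants gives the
   two equations. *)

(** * Continuity on a segment *)

(** The fractional derivatives of dL/dv and dl/dv that occur in the equations are not known to
    exist: stationarity only makes certain sums of kernel integrals differentiable. Hence nothing is
    integrated by parts. The variation is parametrized by its derivative eta, every transfer is an
    exchange of integrals without boundary terms, and the derivatives of the separate terms enter
    only at the very end, as hypotheses at the point x. With Z x the integral of dL/dz over [x, b],
    the memory variable z amounts to replacing the y, v, w partials of L by those of L + Z l. The
    vanishing of eta up to a has two effects: h is C^1 across a and leaves phi untouched, and the
    integrals of delayed terms, once shifted by tau, start at a. The C^1 hypotheses are stated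
    through partial derivatives on a slab that is closed in x. The expansion of J is therefore built
    one coordinate at a time, never moving x, and uniformly in x so that it passes under the
    integral signs. *)

Lemma within_comp (X Y Z : topologicalType) (A : set X) (B : set Y)
    (g : X -> Y) (f : Y -> Z) :
  {within A, continuous g} -> {within B, continuous f} ->
  (forall p, A p -> B (g p)) -> {within A, continuous (f \o g)}.
Proof.
move=> /subspace_continuousP cg /subspace_continuousP cf AB.
apply/subspace_continuousP => p Ap P /= HP.
have H1 : nbhs (g p) (fun q => B q -> P (f q)) := cf (g p) (AB p Ap) P HP.
have H2 : nbhs p (fun q => A q -> B (g q) -> P (f (g q))) := cg p Ap _ H1.
apply: (filterS _ H2 : nbhs p _) => q H3 Aq; exact: H3 (AB q Aq).
Qed.

Section clip.
Context {R : realType}.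
Implicit Types (a b x t : R) (f g : R -> R).

(** Projection of the line onto [a, b]. Composing with it extends a function continuous on the
    segment to one continuous on the whole line, where two-sided results apply even at a and b. *)
Definition clip a b x := Num.max a (Num.min b x).

Lemma clip_itv a b x : a <= b -> a <= clip a b x <= b.
Proof.
move=> ab; rewrite /clip le_max lexx/= ge_max ab/= ge_min lexx //.
Qed.

Lemma clip_id a b x : a <= x <= b -> clip a b x = x.
Proof.
by move=> /andP[ax xb]; rewrite /clip; rewrite min_r// max_r.
Qed.

Lemma continuous_clip a b : continuous (clip a b).
Proof.
move=> x; apply: (@continuous_max R R (cst a) (fun x => Num.min b x)).
  exact: cst_continuous.
apply: (@continuous_min R R (cst b) id); first exact: cst_continuous.
by move=> ?.
Qed.

Lemma continuous_comp_clip a b f : a <= b ->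
  {within `[a, b], continuous f} -> continuous (f \o clip a b).
Proof.
move=> ab cf; suff H : {within setT, continuous (f \o clip a b)}.
  by move=> x P /= /(H x); rewrite nbhs_subspaceT.
apply: (within_comp _ cf) => [|x _]; last by rewrite /= in_itv/= clip_itv.
exact/continuous_subspaceT/continuous_clip.
Qed.

Lemma within_itv_sub a b a' b' f : a' <= a -> b <= b' ->
  {within `[a', b'], continuous f} -> {within `[a, b], continuous f}.
Proof.
move=> aa bb; apply: continuous_subspaceW.
by apply: subset_itv; rewrite bnd_simp.
Qed.

Lemma within_itv_shift a b c f :
  {within `[a, b], continuous f} ->
  {within `[a - c, b - c], continuous (fun x => f (x + c))}.
Proof.
move=> cf; apply: (within_comp _ cf).
  apply: continuous_subspaceT => x; apply: continuousD => //.
  exact: cst_continuous.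
by move=> x; rewrite /= !in_itv/= => /andP[? ?]; apply/andP; split; lra.
Qed.

Lemma within_continuous_eq a b f g :
  (forall x, a <= x <= b -> f x = g x) ->
  {within `[a, b], continuous f} -> {within `[a, b], continuous g}.
Proof.
move=> fg cf; apply: (subspace_eq_continuous _ cf) => x.
by rewrite inE /= in_itv/=; exact: fg.
Qed.

Lemma within_continuousD_fun (A : set R) f g : {within A, continuous f} ->
  {within A, continuous g} -> {within A, continuous (fun x => f x + g x)}.
Proof. exact: within_continuousD. Qed.

Lemma within_continuousM (A : set R) f g : {within A, continuous f} ->
  {within A, continuous g} -> {within A, continuous (fun x => f x * g x)}.
Proof. by move=> cf cg x; apply: continuousM; [exact: cf|exact: cg]. Qed.

Lemma continuous_within f (A : set R) : continuous f -> {within A, continuous f}.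
Proof. exact: continuous_subspaceT. Qed.

Lemma within_continuous_delay a b c f : continuous f ->
  {within `[a, b], continuous (fun x => f (x - c))}.
Proof.
move=> cf; apply: continuous_within => x.
apply: (@continuous_comp _ _ _ (fun x => x - c) f); last exact: cf.
by apply: (@continuousB _ _ _ id (cst c)) => //; exact: cst_continuous.
Qed.

Lemma within_continuous_cst (A : set R) (k : R) : {within A, continuous (fun=> k)}.
Proof. by apply: continuous_subspaceT => x; exact: cst_continuous. Qed.

Lemma within_itv_integrable a b f : {within `[a, b], continuous f} ->
  (@lebesgue_measure R).-integrable `[a, b] (EFin \o f).
Proof. exact/continuous_compact_integrable/segment_compact. Qed.

Lemma within_itv_bounded a b f : {within `[a, b], continuous f} ->
  exists2 M, 0 <= M & forall x, a <= x <= b -> `|f x| <= M.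
Proof.
move=> cf.
have /compact_bounded[M [_ HM]] := continuous_compact cf (@segment_compact _ a b).
exists (`|M| + 1) => // x xab; apply: (HM (`|M| + 1)).
  by rewrite (le_lt_trans (ler_norm M))// ltrDl.
by exists x => //=; rewrite in_itv.
Qed.

End clip.

(** * Fractional kernels *)

Section reflection.
Context {R : realType}.
Notation mu := (@lebesgue_measure R).
Implicit Types (c : R) (f g : R -> R).

Lemma measurable_reflect c : measurable_fun setT (fun t : R => c - t).
Proof.
apply: continuous_measurable_fun => t; apply: continuousB => //.
exact: cst_continuous.
Qed.

(** Lebesgue measure is determined by its values on half-open intervals. A reflection moves the
    closed end of such an interval to the other side, which does not change its length. *)
Lemma lebesgue_measure_reflect c (A : set R) : measurable A ->
  pushforward mu ((fun t => c - t) : _ -> measurableTypeR R) A = mu A.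
Proof.
move=> mA; apply/esym.
apply: lebesgue_measure_unique => //=; first exact: measurable_reflect.
move=> _ _ [[u v]] _ <-.
rewrite /pushforward/=.
have -> : (fun t => c - t) @^-1` `]u, v] = `[c - v, c - u[%classic.
  apply/seteqP; split => t /=; rewrite !in_itv/= => /andP[? ?];
    apply/andP; split; lra.
rewrite !lebesgue_measure_itv/= !lte_fin ltrD2l ltrN2.
by case: ifPn => // _; rewrite -!EFinB; congr EFin; ring.
Qed.

Lemma integrable_reflect c (g : R -> R) : mu.-integrable setT (EFin \o g) ->
  mu.-integrable setT (EFin \o (fun t => g (c - t))).
Proof.
move=> ig; have mg := measurable_int _ ig.
have mr := @measurable_reflect c.
apply/integrableP; split.
  exact: (measurableT_comp mg mr).
move/integrableP : ig => [_]; apply: le_lt_trans.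
pose r : R -> measurableTypeR R := fun t => c - t.
rewrite -[leLHS]/(\int[mu]_(x in r @^-1` setT)
  ((fun y => `|(g y)%:E|%E) \o r) x)%E.
rewrite -ge0_integral_pushforward//; last exact: measurableT_comp.
rewrite (@eq_measure_integral _ _ _ _ mu)// => A mA _.
exact: lebesgue_measure_reflect.
Qed.

Lemma Rintegral_reflect c (g : R -> R) : mu.-integrable setT (EFin \o g) ->
  \int[mu]_t g (c - t) = \int[mu]_t g t.
Proof.
move=> ig; have mg := measurable_int _ ig.
have mr := @measurable_reflect c.
rewrite /Rintegral; congr fine.
pose r : R -> measurableTypeR R := fun t => c - t.
rewrite -[LHS]/(\int[mu]_(x in r @^-1` setT) ((EFin \o g) \o r) x)%E.
rewrite -integral_pushforward//; last exact: integrable_reflect.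
apply: eq_measure_integral => A mA _.
exact: lebesgue_measure_reflect.
Qed.

(** A translation is the composition of the reflections in [c - t] and in [0 - t], so reflection
    invariance is enough. *)
Lemma integrable_shift c (g : R -> R) : mu.-integrable setT (EFin \o g) ->
  mu.-integrable setT (EFin \o (fun t => g (t + c))).
Proof.
move=> /(@integrable_reflect c)/(@integrable_reflect 0).
by apply: eq_integrable => //= t _; rewrite sub0r opprK addrC.
Qed.

Lemma Rintegral_shift c (g : R -> R) : mu.-integrable setT (EFin \o g) ->
  \int[mu]_t g (t + c) = \int[mu]_t g t.
Proof.
move=> ig; rewrite -(Rintegral_reflect c ig).
rewrite -(Rintegral_reflect 0 (integrable_reflect c ig)).
by apply: eq_Rintegral => t _; rewrite sub0r opprK addrC.
Qed.

End reflection.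

Section kernel.
Context {R : realType}.
Notation mu := (@lebesgue_measure R).
Implicit Types (s T a b x : R) (f g : R -> R).

(** The singularity at 0 (for s < 0) is approached through the segments [1 / (n + 1), T], on which
    [G] is a genuine antiderivative; monotone convergence then carries a bound uniform in n over to
    ]0, T]. *)
Lemma integrable_powR s T : -1 < s -> mu.-integrable `[0, T] (EFin \o (fun u => u `^ s)).
Proof.
move=> s1; have [T0|T0] := leP T 0.
  apply: (@integrableS _ _ _ mu [set 0]) => //; last first.
    apply/integrableP; split; last by rewrite integral_set1.
    by apply/measurable_EFinP; apply: measurable_funTS; exact: measurable_powR.
  by move=> t /=; rewrite in_itv/= => /andP[? ?]; apply/eqP; rewrite eq_le; lra.
have mp : measurable_fun setT (fun u : R => u `^ s) by exact: measurable_powR.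
have mpE : measurable_fun setT (EFin \o (fun u : R => u `^ s)) by exact/measurable_EFinP.
apply/integrableP; split; first exact/measurable_EFinP/measurable_funTS.
under eq_integral do rewrite /= ger0_norm ?powR_ge0//.
rewrite -integral_itv_obnd_cbnd; last exact/measurable_EFinP/measurable_funTS.
pose F (n : nat) : set R := `[n.+1%:R^-1, T]%classic.
have -> : `]0, T]%classic = \bigcup_n F n.
  apply/seteqP; split => t /=.
    rewrite in_itv/= => /andP[t0 tT].
    exists (Num.truncn (t^-1)) => //; rewrite /F /= in_itv/= tT andbT.
    by rewrite invf_ple ?posrE// ltW// truncnS_gt.
  move=> [n _]; rewrite /F /= !in_itv/= => /andP[+ ->]; rewrite andbT.
  exact: lt_le_trans.
have H := @ge0_nondecreasing_set_cvg_integral _ (measurableTypeR R) R F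
  (fun x => (x `^ s)%:E) mu.
have {}H : (\int[mu]_(x in F i) (x `^ s)%:E @[i --> \oo] -->
  \int[mu]_(x in \bigcup_i F i) (x `^ s)%:E)%E.
  apply: H => //.
  - apply/nondecreasing_seqP => n; apply/subsetPset => t.
    rewrite /F /= !in_itv/= => /andP[+ ->]; rewrite andbT.
    by apply: le_trans; rewrite lef_pV2 ?posrE// ler_nat.
  - by move=> n; exact: measurable_itv.
  - by move=> n; exact: measurable_funTS mpE.
  - by move=> n x _; rewrite lee_fin powR_ge0.
(* The bound is the value of the antiderivative at T; its value at 1 / (n + 1) is nonnegative
   because s + 1 > 0, and is dropped. *)
suff B n : (\int[mu]_(x in F n) (x `^ s)%:E <= (T `^ (s + 1) / (s + 1))%:E)%E.
  apply: (@le_lt_trans _ _ (T `^ (s + 1) / (s + 1))%:E); last exact: ltry.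
  apply: (cvge_le _ H); exact: nearW.
have s10 : 0 < s + 1 by lra.
have n0 : 0 < n.+1%:R^-1 :> R by rewrite invr_gt0.
(* When T does not exceed 1 / (n + 1), the segment [F n] has at most one point. *)
have [Tn|nT] := leP T n.+1%:R^-1.
  rewrite (integral_Sset1 n.+1%:R^-1); first by rewrite lee_fin divr_ge0 ?powR_ge0// ltW.
  move=> t; rewrite /F /= in_itv/= => /andP[nt tT].
  by apply/eqP; rewrite eq_le nt (le_trans tT Tn).
pose G := ((s + 1)^-1 \*: (fun x : R => x `^ (s + 1))) : R -> R.
have dG (t : R) : 0 < t -> is_derive t 1 G (t `^ s).
  move=> t0; have := is_deriveZ (s + 1)^-1 (is_derive1_powR (s + 1) t0).
  by rewrite addrK scalerA mulVf ?scale1r ?gt_eqF.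
have dp (t : R) : 0 < t -> derivable (fun u : R => u `^ s) t 1.
  by move=> t0; have [] := is_derive1_powR s t0.
have cp : {within `[n.+1%:R^-1, T], continuous (fun u : R => u `^ s)}.
  apply: derivable_within_continuous => t.
  by rewrite in_itv/= => /andP[? _]; apply: dp; exact: lt_le_trans n0 _.
have cG : {within `[n.+1%:R^-1, T], continuous G}.
  apply: derivable_within_continuous => t.
  rewrite in_itv/= => /andP[? _]; have [//|//] := dG t.
  exact: lt_le_trans n0 _.
have -> : (\int[mu]_(x in F n) (x `^ s)%:E = (G T)%:E - (G n.+1%:R^-1)%:E)%E.
  apply: continuous_FTC2 => //.
  - have [cg1 cg2 cg3] := (continuous_within_itvP _ nT).1 cG.
    split => // t; rewrite in_itv/= => /andP[? _].
    by have [//|//] := dG t; exact: lt_trans n0 _.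
  - move=> t; rewrite in_itv/= => /andP[? _]; rewrite derive1E.
    by have [//|//] := dG t; exact: lt_trans n0 _.
rewrite -EFinB lee_fin /G /= -/(_ / _).
rewrite [X in X - _]mulrC lerBlDr lerDl mulr_ge0 ?powR_ge0// invr_ge0 ltW//.
Qed.

(* The restriction to [0, T] also discards the junk value 1 of u `^ s for u < 0. *)
Definition kern s T : R -> R := (fun u => u `^ s) \_ `[0, T].

Lemma kern_integrable s T : -1 < s -> mu.-integrable setT (EFin \o kern s T).
Proof.
move=> s1; rewrite /kern -restrict_EFin.
apply/integrable_restrict => //; rewrite setTI.
exact: integrable_powR.
Qed.

Lemma kern_ge0 s T u : 0 <= kern s T u.
Proof. by rewrite /kern patchE; case: ifPn => // _; rewrite powR_ge0. Qed.

(** Makes the fractional integral a convolution over the whole line, with an integrable kernel that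
    no longer depends on x. For t and x in [a, b] the bound x - t <= b - a is automatic, so the
    cut-off in [kern] only expresses t <= x. *)
Lemma left_kernel_restrict s a b x f t : a <= x <= b ->
  (left_integrand s x f \_ `[a, x]) t = kern s (b - a) (x - t) * (f \_ `[a, b]) t.
Proof.
move=> /andP[ax xb]; rewrite /kern !patchE !mem_setE !in_itv/= /left_integrand.
case: ifPn => [/andP[at_ tx]|H].
  by rewrite ifT ?ifT//; apply/andP; split; lra.
case: ifPn => [/andP[? ?]|]; last by rewrite mul0r.
rewrite ifN ?mulr0//; apply: contra H => /andP[? ?]; apply/andP; split; lra.
Qed.

Lemma right_kernel_restrict s a b x f t : a <= x <= b ->
  ((fun t => (t - x) `^ s * f t) \_ `[x, b]) t = kern s (b - a) (t - x) * (f \_ `[a, b]) t.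
Proof.
move=> /andP[ax xb]; rewrite /kern !patchE !mem_setE !in_itv/=.
case: ifPn => [/andP[at_ tx]|H].
  by rewrite ifT ?ifT//; apply/andP; split; lra.
case: ifPn => [/andP[? ?]|]; last by rewrite mul0r.
rewrite ifN ?mulr0//; apply: contra H => /andP[? ?]; apply/andP; split; lra.
Qed.

End kernel.

(** * Kernel integrals as convolutions, and fractional integration by parts *)

Section kernel_ops.
Context {R : realType}.
Notation mu := (@lebesgue_measure R).
Implicit Types (s T a b x : R) (f g F G : R -> R).

(** Cutting a continuous function off to a segment destroys its continuity at the ends but keeps it
    in this class, which is what a product with an integrable kernel requires. *)
Definition bounded_measurable F :=
  measurable_fun setT F /\ exists M, forall x, `|F x| <= M.

Lemma bounded_measurable_restrict a b f : {within `[a, b], continuous f} ->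
  bounded_measurable (f \_ `[a, b]).
Proof.
move=> cf; split.
  apply: (iffLR (measurable_restrictT _ _)) => //.
  exact: subspace_continuous_measurable_fun.
have [M M0 HM] := within_itv_bounded cf; exists M => x.
rewrite patchE; case: ifPn; last by rewrite normr0.
by rewrite inE/= in_itv/=; exact: HM.
Qed.

Lemma integrableM_bounded f F : mu.-integrable setT (EFin \o f) ->
  bounded_measurable F -> mu.-integrable setT (EFin \o (fun t => f t * F t)).
Proof.
move=> fi [mF [M HM]].
have -> : (EFin \o (fun t => f t * F t)) = ((EFin \o f) \* (EFin \o F))%E by [].
apply: integrableMl => //.
exists M; split; first by rewrite num_real.
by move=> N MN x _; exact: le_trans (HM x) (ltW MN).
Qed.

Lemma integrable_kern_left s T x F : -1 < s -> bounded_measurable F ->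
  mu.-integrable setT (EFin \o (fun t => kern s T (x - t) * F t)).
Proof.
move=> s1; apply: integrableM_bounded.
exact: (integrable_reflect x (kern_integrable T s1)).
Qed.

Lemma integrable_kern_right s T x F : -1 < s -> bounded_measurable F ->
  mu.-integrable setT (EFin \o (fun t => kern s T (t - x) * F t)).
Proof.
move=> s1; apply: integrableM_bounded.
exact: (integrable_shift (- x) (kern_integrable T s1)).
Qed.

Lemma left_kernel_integrable s a b x f : -1 < s -> a <= x <= b ->
  {within `[a, b], continuous f} ->
  mu.-integrable `[a, x] (EFin \o left_integrand s x f).
Proof.
move=> s1 axb cf.
have := integrable_kern_left (b - a) x s1 (bounded_measurable_restrict cf).
rewrite -[`[a, x]%classic in X in _ -> X]setTI => H.
apply/integrable_restrict => //; apply: eq_integrable H => // t _.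
by rewrite restrict_EFin /= (left_kernel_restrict _ _ _ axb).
Qed.

Lemma right_kernel_integrable s a b x f : -1 < s -> a <= x <= b ->
  {within `[a, b], continuous f} ->
  mu.-integrable `[x, b] (EFin \o (fun t => (t - x) `^ s * f t)).
Proof.
move=> s1 axb cf.
have := integrable_kern_right (b - a) x s1 (bounded_measurable_restrict cf).
rewrite -[`[x, b]%classic in X in _ -> X]setTI => H.
apply/integrable_restrict => //; apply: eq_integrable H => // t _.
by rewrite restrict_EFin /= (right_kernel_restrict _ _ _ axb).
Qed.

Lemma left_kernelE s a b x f : a <= x <= b ->
  \int[mu]_(t in `[a, x]) left_integrand s x f t =
  \int[mu]_t (kern s (b - a) (x - t) * (f \_ `[a, b]) t).
Proof.
move=> axb; rewrite Rintegral_mkcond; apply: eq_Rintegral => t _.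
exact: left_kernel_restrict.
Qed.

Lemma right_kernelE s a b x f : a <= x <= b ->
  right_kernel_int s x b f x =
  \int[mu]_t (kern s (b - a) (t - x) * (f \_ `[a, b]) t).
Proof.
move=> axb; rewrite /right_kernel_int Rintegral_mkcond; apply: eq_Rintegral => t _.
exact: right_kernel_restrict.
Qed.

Lemma bounded_measurable_norm F : bounded_measurable F ->
  bounded_measurable (fun x => `|F x|).
Proof.
move=> [mF [M HM]]; split; first exact: measurableT_comp.
by exists M => x; rewrite normr_id.
Qed.

Let Phi s T F G (p : R * R) := (G p.1 * (kern s T (p.1 - p.2) * F p.2))%:E.

Let measurable_Phi s T F G : measurable_fun setT F -> measurable_fun setT G ->
  measurable_fun setT (Phi s T F G).
Proof.
move=> mF mG; apply/measurable_EFinP; apply: measurable_funM => /=.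
  exact: (measurableT_comp mG measurable_fst).
apply: measurable_funM; last exact: (measurableT_comp mF measurable_snd).
have mk : measurable_fun setT (kern s T).
  apply: (iffLR (measurable_restrictT _ _)) => //.
  apply: measurable_funTS; exact: measurable_powR.
apply: (measurableT_comp mk).
by apply: measurable_funB.
Qed.

(** Tonelli's criterion: the inner integral of the absolute value at x is at most [|G x|] times a
    constant, and G is integrable. *)
Let integrable_Phi s T F G : -1 < s ->
  mu.-integrable setT (EFin \o G) -> bounded_measurable F ->
  (mu \x mu)%E.-integrable setT (Phi s T F G).
Proof.
move=> s1 iG bF; have mF := bF.1.
have mG : measurable_fun setT G by apply/measurable_EFinP; exact: measurable_int iG.
have mPhi : measurable_fun setT (Phi s T F G) by exact: measurable_Phi.
apply/integrable12ltyP => //.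
have [M HM] := bF.2.
pose C := \int[mu]_t kern s T t * M.
have kM x : mu.-integrable setT (EFin \o (fun t => kern s T (x - t) * M)).
  apply: (@integrable_kern_left _ _ _ (cst M)) => //; split => //.
  by exists `|M|.
have kF x := integrable_kern_left T x s1 (bounded_measurable_norm bF).
(* The constant is the total mass of the kernel times the bound M of F; reflection invariance makes
   it independent of x. *)
have HC x : \int[mu]_t (kern s T (x - t) * `|F t|) <= C.
  rewrite /C -(Rintegral_reflect x (kern_integrable T s1)) -RintegralZr//; last first.
    exact: (integrable_reflect x (kern_integrable T s1)).
  by apply: le_Rintegral => // t _; rewrite ler_wpM2l ?kern_ge0.
have E x : (\int[mu]_y `|Phi s T F G (x, y)| =
    (`|G x| * \int[mu]_t (kern s T (x - t) * `|F t|))%:E)%E.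
  rewrite -RintegralZl// /Rintegral fineK.
    apply: eq_integral => y _; rewrite /Phi /= !normrM.
    by rewrite (ger0_norm (kern_ge0 _ _ _)).
  apply: integrable_fin_num => //.
  exact: (integrableZl _ `|G x| (kF x)).
apply: (@le_lt_trans _ _ (\int[mu]_x (`|G x| * C)%:E)%E).
  apply: ge0_le_integral => //.
  - by move=> x _; exact: integral_ge0.
  - have mA : measurable_fun setT (abse \o Phi s T F G) by exact: measurableT_comp.
    exact: (@measurable_fun_fubini_tonelli_F _ _ _ _ R mu _ mA (fun=> abse_ge0 _)).
  - by apply/measurable_EFinP; apply: measurable_funM => //; exact: measurableT_comp.
  - by move=> x _; rewrite E lee_fin ler_wpM2l.
have : mu.-integrable setT (fun x => (`|G x|)%:E * C%:E)%E.
  by apply: integrableZr => //; exact: integrable_norm.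
move=> /integrableP[_]; apply: le_lt_trans.
apply: ge0_le_integral => //.
- move=> x _; rewrite lee_fin mulr_ge0// (le_trans _ (HC x))//.
  by apply: Rintegral_ge0 => t _; rewrite mulr_ge0 ?kern_ge0.
- by apply/measurable_EFinP; apply: measurable_funM => //; exact: measurableT_comp.
- apply: measurableT_comp => //; apply/measurable_EFinP; apply: measurable_funM => //.
  exact: measurableT_comp.
- by move=> x _; rewrite EFinM; exact: lee_abs.
Qed.

Lemma Fubini_kern s T F G : -1 < s ->
  mu.-integrable setT (EFin \o G) -> bounded_measurable F -> bounded_measurable G ->
  \int[mu]_x (G x * \int[mu]_t (kern s T (x - t) * F t)) =
  \int[mu]_t (F t * \int[mu]_x (kern s T (x - t) * G x)).
Proof.
move=> s1 iG bF bG.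
have := Fubini (integrable_Phi T s1 iG bF) => /(congr1 fine) H.
rewrite /Rintegral.
transitivity (fine (\int[mu]_x \int[mu]_y Phi s T F G (x, y))).
  congr fine; apply: eq_integral => x _.
  rewrite EFinM fineK; last first.
    by apply: integrable_fin_num => //; exact: integrable_kern_left.
  rewrite -integralZl//; last exact: integrable_kern_left.
rewrite H; congr fine; apply: eq_integral => y _.
rewrite EFinM fineK; last first.
  by apply: integrable_fin_num => //; exact: integrable_kern_right.
rewrite -integralZl//; last exact: integrable_kern_right.
apply: eq_integral => x _; rewrite /Phi /= -EFinM; congr EFin; ring.
Qed.

(** Fractional integration by parts. On the triangle a <= t <= x <= b the kernel (x - t)^s is a left
    kernel when integrated in t and a right kernel when integrated in x. *)
Lemma Fubini_kernel s a b f g : -1 < s ->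
  {within `[a, b], continuous f} -> {within `[a, b], continuous g} ->
  \int[mu]_(x in `[a, b]) (g x * \int[mu]_(t in `[a, x]) left_integrand s x f t) =
  \int[mu]_(t in `[a, b]) (f t * right_kernel_int s t b g t).
Proof.
move=> s1 cf cg.
have := @Fubini_kern s (b - a) (f \_ `[a, b]) (g \_ `[a, b]) s1.
have ig : mu.-integrable setT (EFin \o (g \_ `[a, b])).
  rewrite -restrict_EFin; apply/integrable_restrict => //; rewrite setTI.
  exact: within_itv_integrable.
move=> /(_ ig (bounded_measurable_restrict cf) (bounded_measurable_restrict cg)) H.
rewrite Rintegral_mkcond [RHS]Rintegral_mkcond.
transitivity (\int[mu]_x
    ((g \_ `[a, b]) x * \int[mu]_t (kern s (b - a) (x - t) * (f \_ `[a, b]) t))).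
  apply: eq_Rintegral => x _; rewrite !patchE; case: ifPn; last by rewrite mul0r.
  by rewrite inE/= in_itv/= => xab; rewrite (left_kernelE _ _ xab).
rewrite H; apply: eq_Rintegral => x _; rewrite [in LHS]patchE [in RHS]patchE.
case: ifPn; last by rewrite mul0r.
by rewrite inE/= in_itv/= => xab; rewrite (right_kernelE _ _ xab).
Qed.

End kernel_ops.

(** * Continuity of kernel integrals in their endpoint *)

Section kernel_continuity.
Context {R : realType}.
Notation mu := (@lebesgue_measure R).
Implicit Types (s T a b x : R) (f g F G : R -> R).

Lemma continuous_comp_sub (f : R -> R) x : continuous f -> continuous (fun u => f (x - u)).
Proof.
move=> cf u; apply: (@continuous_comp _ _ _ (fun u => x - u) f); last exact: cf.
by apply: continuousB; [exact: cst_continuous|move=> ?].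
Qed.

(** The variable x sits in the continuous factor f and not in the singular kernel, so dominated
    convergence applies with the dominating function M times the kernel. *)
Lemma kern_convolution_continuous s T M f : -1 < s -> continuous f ->
  (forall x, `|f x| <= M) ->
  continuous (fun x => \int[mu]_u (kern s T u * f (x - u))).
Proof.
move=> s1 cf HM x0.
have ir x : mu.-integrable setT (EFin \o (fun u => kern s T u * f (x - u))).
  apply: integrableM_bounded; first exact: kern_integrable.
  split; last by exists M.
  by apply: continuous_measurable_fun; exact: continuous_comp_sub.
apply: (@continuity_under_integral R _ _ mu (fun x u => kern s T u * f (x - u))
  setT measurableT (x0 - 1) (x0 + 1) _ _ (fun u => kern s T u * M)).
- by move=> x _.
- apply: aeW => u _ x _.
  apply: (@continuousM R R (cst (kern s T u)) (fun x => f (x - u))).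
    exact: cst_continuous.
  apply: (@continuous_comp _ _ _ (fun x => x - u) f); last exact: cf.
  by apply: continuousB; [move=> ?|exact: cst_continuous].
- apply: (@integrableM_bounded _ _ (cst M)); first exact: kern_integrable.
  by split => //; exists `|M|.
- move=> x _; apply: aeW => u _.
  by rewrite normrM ger0_norm ?kern_ge0// ler_wpM2l ?kern_ge0.
- by rewrite inE/= in_itv/=; apply/andP; split; lra.
Qed.

Lemma left_kernel_continuous s a b f : -1 < s -> a <= b ->
  {within `[a, b], continuous f} ->
  {within `[a, b], continuous
     (fun x => \int[mu]_(t in `[a, x]) left_integrand s x f t)}.
Proof.
move=> s1 ab cf.
(* Subtracting f a makes the extension by 0 to the left of a continuous. *)
pose eta x := f (clip a b x) - f a.
have ceta : continuous eta.
  move=> x; apply: continuousB; last exact: cst_continuous.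
  exact: continuous_comp_clip.
have eta0 x : x <= a -> eta x = 0.
  by move=> xa; rewrite /eta /clip max_l ?subrr// ge_min xa orbT.
have [M M0 HM] := within_itv_bounded cf.
have etaM x : `|eta x| <= M + M.
  rewrite (le_trans (ler_normB _ _))// lerD// HM// ?lexx//.
  exact: clip_itv.
have cp : {within `[0, b - a], continuous (fun x => \int[mu]_(u in `[0, x]) (u `^ s))}.
  apply: parameterized_integral_continuous; first by rewrite subr_ge0.
  exact: integrable_powR.
(* The first term is the convolution with the extended [eta]; the second is the contribution of the
   constant f a, for which t = x - u turns the integral over [a, x] into one of u^s over
   [0, x - a]. *)
pose h x := \int[mu]_u (kern s (b - a) u * eta (x - u)) +
   f a * \int[mu]_(u in `[0, x + - a]) (u `^ s).
apply: (@within_continuous_eq _ _ _ h); last first.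
  apply: (@within_continuousD _ _ _ `[a, b]
    (fun x => \int[mu]_u (kern s (b - a) u * eta (x - u)))
    (fun x => f a * \int[mu]_(u in `[0, x + - a]) (u `^ s))).
    apply: continuous_subspaceT; exact: (kern_convolution_continuous s1 ceta etaM).
  apply: within_continuousM; first exact: within_continuous_cst.
  have := within_itv_shift (c := - a) cp.
  by rewrite opprK add0r subrK.
move=> x xab; rewrite (left_kernelE _ _ xab) /h.
have bf := bounded_measurable_restrict cf.
rewrite -(Rintegral_reflect x (integrable_kern_left _ _ s1 bf)).
rewrite [in X in _ + _ * X = _]Rintegral_mkcond.
have ip : mu.-integrable setT (EFin \o ((fun u => u `^ s) \_ `[0, x - a])).
  exact: (kern_integrable (x - a) s1).
have ie : mu.-integrable setT (EFin \o (fun u => kern s (b - a) u * eta (x - u))).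
  apply: integrableM_bounded; first exact: kern_integrable.
  split; last by exists (M + M).
  by apply: continuous_measurable_fun; exact: continuous_comp_sub.
rewrite -RintegralZl// -RintegralD//; last exact: integrableZl ip.
apply: eq_Rintegral => u _.
rewrite subKr /kern !patchE !mem_setE !in_itv/=.
move: xab => /andP[ax xb].
case: ifPn => [/andP[u0 uT]|uT]; last first.
  rewrite !mul0r ifN ?mulr0 ?addr0//.
  by apply: contra uT => /andP[? ?]; apply/andP; split; lra.
rewrite u0/=; have [ua|ua] := leP u (x - a).
  rewrite ifT; last by apply/andP; split; lra.
  by rewrite /eta clip_id; [ring|apply/andP; split; lra].
by rewrite ifN ?eta0 ?mulr0 ?addr0//; [lra|rewrite negb_and -!ltNge; apply/orP; left; lra].
Qed.

Lemma Rintegral_itv_reflect a b x f : a <= x <= b ->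
  mu.-integrable `[x, b] (EFin \o f) ->
  \int[mu]_(t in `[x, b]) f t = \int[mu]_(t in `[a, a + b - x]) f (a + b - t).
Proof.
move=> /andP[ax xb] fi; rewrite Rintegral_mkcond -(Rintegral_reflect (a + b)).
  rewrite [RHS]Rintegral_mkcond; apply: eq_Rintegral => t _.
  rewrite !patchE !mem_setE !in_itv/=; congr (if _ then _ else _).
  by apply/idP/idP => /andP[? ?]; apply/andP; split; lra.
by rewrite -restrict_EFin; apply/integrable_restrict => //; rewrite setTI.
Qed.

Lemma within_itv_reflect a b f : {within `[a, b], continuous f} ->
  {within `[a, b], continuous (fun x => f (a + b - x))}.
Proof.
move=> cf; apply: (within_comp _ cf).
  by apply: continuous_subspaceT; apply: (@continuous_comp_sub id) => ?.
by move=> x; rewrite /= !in_itv/= => /andP[? ?]; apply/andP; split; lra.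
Qed.

(** The reflection t |-> a + b - t preserves [a, b] and exchanges right and left kernels. *)
Lemma right_kernel_continuous s a b f : -1 < s -> a <= b ->
  {within `[a, b], continuous f} ->
  {within `[a, b], continuous (fun x => right_kernel_int s x b f x)}.
Proof.
move=> s1 ab cf.
have := within_itv_reflect (left_kernel_continuous s1 ab (within_itv_reflect cf)).
apply: within_continuous_eq => x xab.
rewrite /right_kernel_int (Rintegral_itv_reflect xab); last first.
  exact: (right_kernel_integrable s1 xab cf).
by apply: eq_Rintegral => t _; rewrite /left_integrand addrAC.
Qed.

End kernel_continuity.

(** * Derivatives along a subset of the line *)

Section deriv_on.
Context {R : realType}.
Implicit Types (S : set R) (F G : R -> R) (x d : R).

(** Relational form of [deriv_on]: the rules of calculus are convergence statements valid for any
    filter, and properness is called for only when a value is read off in [is_deriv_on_val]. *)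
Definition is_deriv_on S F x d := diff_quot F x @ within S x^' --> d.

(** Gives uniqueness of derivatives along a segment, endpoints included. A point of the segment near
    x and distinct from it is taken to the right of x, or to the left when x = q; the minimum keeps
    it both in the ball and in the segment. *)
Lemma within_itv_dnbhs_proper (p q x : R) : p < q -> p <= x <= q ->
  ProperFilter (within `[p, q] x^').
Proof.
move=> pq /andP[px xq]; apply: Build_ProperFilter_ex => P.
rewrite /within/= => -[e /= e0 H].
have [xltq|qlex] := ltP x q.
- pose t := x + Num.min (e / 2) (q - x).
  have m0 : 0 < Num.min (e / 2) (q - x) by rewrite lt_min divr_gt0// subr_gt0.
  have m1 : Num.min (e / 2) (q - x) <= q - x by rewrite ge_min lexx orbT.
  have m2 : Num.min (e / 2) (q - x) <= e / 2 by rewrite ge_min lexx.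
  exists t; apply: H => /=.
  + rewrite /t opprD addrA subrr sub0r normrN gtr0_norm//.
    by rewrite (le_lt_trans m2)// ltr_pdivrMr// ltr_pMr// ltr1n.
  + by rewrite /t gt_eqF// ltrDl.
  + by rewrite /t in_itv/=; apply/andP; split; lra.
- have {}xq : x = q by apply/eqP; rewrite eq_le xq qlex.
  subst x.
  pose t := q - Num.min (e / 2) (q - p).
  have m0 : 0 < Num.min (e / 2) (q - p) by rewrite lt_min divr_gt0// subr_gt0.
  have m1 : Num.min (e / 2) (q - p) <= q - p by rewrite ge_min lexx orbT.
  have m2 : Num.min (e / 2) (q - p) <= e / 2 by rewrite ge_min lexx.
  exists t; apply: H => /=.
  + rewrite /t opprB addrCA subrr addr0 gtr0_norm//.
    by rewrite (le_lt_trans m2)// ltr_pdivrMr// ltr_pMr// ltr1n.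
  + by rewrite /t lt_eqF// gtrDl oppr_lt0.
  + by rewrite /t in_itv/=; apply/andP; split; lra.
Qed.

Lemma is_deriv_on_deriv S F x : derivable_on S F x ->
  is_deriv_on S F x (deriv_on S F x).
Proof. by []. Qed.

Lemma is_deriv_on_derivable S F x d : is_deriv_on S F x d -> derivable_on S F x.
Proof. by move=> H; apply/cvg_ex; exists d. Qed.

Lemma is_deriv_on_val S F x d : ProperFilter (within S x^') ->
  is_deriv_on S F x d -> deriv_on S F x = d.
Proof. by move=> PF H; apply/cvg_lim. Qed.

Lemma is_deriv_onD S F G x d e : is_deriv_on S F x d -> is_deriv_on S G x e ->
  is_deriv_on S (fun u => F u + G u) x (d + e).
Proof.
move=> HF HG.
rewrite /is_deriv_on.
have -> : diff_quot (fun u => F u + G u) x = diff_quot F x \+ diff_quot G x.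
  by apply/funext => u; rewrite /diff_quot/= -mulrDl; congr (_ * _); ring.
exact: cvgD.
Qed.

Lemma is_deriv_onZ S F x d (k : R) : is_deriv_on S F x d ->
  is_deriv_on S (fun u => k * F u) x (k * d).
Proof.
move=> HF.
rewrite /is_deriv_on.
have -> : diff_quot (fun u => k * F u) x = (fun u => k * diff_quot F x u).
  by apply/funext => u; rewrite /diff_quot/=; ring.
exact: cvgMl_tmp.
Qed.

Lemma is_deriv_on_cst S (k x : R) : is_deriv_on S (fun=> k) x 0.
Proof.
rewrite /is_deriv_on.
have -> : diff_quot (fun=> k) x = cst 0.
  by apply/funext => u; rewrite /diff_quot subrr mul0r.
exact: cvg_cst.
Qed.

Lemma is_deriv_on_eq S F G x d : S x -> {in S, F =1 G} ->
  is_deriv_on S F x d -> is_deriv_on S G x d.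
Proof.
move=> Sx FG; apply: cvg_trans; apply: near_eq_cvg.
apply: filterS (near_withinT S _) => u Su; by rewrite /diff_quot !FG ?inE.
Qed.

Lemma is_deriv_on_subset S S' F x d : S' `<=` S -> is_deriv_on S F x d ->
  is_deriv_on S' F x d.
Proof.
move=> sub; apply: cvg_trans; apply: cvg_app => P [e e0 H].
by exists e => // u xu ux S'u; apply: H => //; exact: sub.
Qed.

Lemma derive_cvgP F x d : is_derive x 1 F d <->
  (fun h => h^-1 *: ((F \o shift x) (h *: (1 : R)) - F x)) @ 0^' --> d.
Proof.
split=> [[+ <-]|H]; first by move=> H; exact: H.
split; first by apply/cvg_ex; exists d.
exact/cvg_lim.
Qed.

Lemma is_derive_is_deriv_on S F x d : is_derive x 1 F d -> is_deriv_on S F x d.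
Proof.
move=> /derive_cvgP/cvgrPdist_lt H; apply/cvgrPdist_lt => e e0.
have [r /= r0 Hr] := H e e0; exists r => //= u xur ux Su.
have := Hr (u - x); rewrite /= sub0r normrN distrC => /(_ xur).
rewrite subr_eq0 => /(_ ux).
by rewrite /diff_quot [_ *: 1]mulr1 /= subrK mulrC.
Qed.

(** At an interior point of S small increments never leave S, so the relative derivative is the
    usual one. *)
Lemma is_deriv_on_is_derive S F x d : nbhs x S -> is_deriv_on S F x d ->
  is_derive x 1 F d.
Proof.
move=> [r0 /= r00 Hr0] /cvgrPdist_lt H; apply/derive_cvgP/cvgrPdist_lt => e e0.
have [r /= r1 Hr] := H e e0; exists (Num.min r r0); rewrite /= ?lt_min ?r1//.
move=> h /=; rewrite sub0r normrN lt_min => /andP[hr hr0] h0.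
have xE : `|x - (h + x)| = `|h| by rewrite opprD addrCA subrr addr0 normrN.
have := Hr (h + x); rewrite /= xE => /(_ hr).
rewrite -subr_eq0 addrK => /(_ h0).
have Sh : S (h + x) by apply: Hr0; rewrite /= xE.
by move=> /(_ Sh); rewrite /diff_quot addrK [_ *: 1]mulr1 /= mulrC.
Qed.

End deriv_on.

(** * Uniform first-order expansions *)

Section first_order.
Context {R : realType}.
Notation mu := (@lebesgue_measure R).

(** Uniformity in x is the point of this notion: it lets a derivative in eps at 0 pass under an
    integral by a mere length estimate, and it survives composition with a C^1 function along a
    compact curve. *)
Definition first_order (a b : R) (F : R -> R -> R) (d : R -> R) :=
  forall e, 0 < e -> exists2 r, 0 < r & forall eps, `|eps| < r ->
    forall x, a <= x <= b -> `|F eps x - F 0 x - eps * d x| <= e * `|eps|.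

Lemma first_order_linear a b (u d : R -> R) (F : R -> R -> R) :
  (forall eps x, a <= x <= b -> F eps x = u x + eps * d x) ->
  first_order a b F d.
Proof.
move=> FE e e0; exists 1 => // eps _ x xab.
rewrite !FE// mul0r addr0 [X in `|X|](_ : _ = 0); last by ring.
by rewrite normr0 mulr_ge0// ltW.
Qed.

Lemma first_order_Rintegral a b (F : R -> R -> R) (d : R -> R) :
  (forall eps, mu.-integrable `[a, b] (EFin \o F eps)) ->
  mu.-integrable `[a, b] (EFin \o d) ->
  first_order a b F d ->
  first_order a b (fun eps x => \int[mu]_(t in `[a, x]) F eps t)
    (fun x => \int[mu]_(t in `[a, x]) d t).
Proof.
move=> iF id H e e0.
have [ba|ab] := ltP b a.
  by exists 1 => // eps _ x /andP[? ?]; lra.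
(* The tolerance is divided by a bound for the length x - a; the added 1 keeps this bound positive
   when a = b. *)
have ba1 : 0 < b - a + 1 by lra.
have [r r0 Hr] := H (e / (b - a + 1)) (divr_gt0 e0 ba1).
exists r => // eps epsr x /andP[ax xb].
have sub : `[a, x] `<=` `[a, b] by apply: subset_itvl; rewrite bnd_simp.
have iFx eps' : mu.-integrable `[a, x] (EFin \o F eps') by apply: integrableS (iF eps').
have idx : mu.-integrable `[a, x] (EFin \o d) by apply: integrableS id.
have izd : mu.-integrable `[a, x] (EFin \o (fun t => eps * d t)).
  exact: (integrableZl _ eps idx).
have iB : mu.-integrable `[a, x] (EFin \o (fun t => F eps t - F 0 t)).
  exact: (integrableB _ (iFx eps) (iFx 0)).
rewrite -RintegralZl// -RintegralB// -RintegralB//.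
rewrite (le_trans (le_normr_Rintegral _ _))//; first exact: (integrableB _ iB izd).
apply: (@le_trans _ _ (\int[mu]_(t in `[a, x]) (e / (b - a + 1) * `|eps|))).
  apply: le_Rintegral => //.
  - exact: integrable_norm (integrableB _ iB izd).
  - by apply: within_itv_integrable; exact: within_continuous_cst.
  - move=> t; rewrite /= in_itv/= => /andP[at_ tx].
    by apply: Hr => //; rewrite at_ (le_trans tx).
rewrite Rintegral_cst//= lebesgue_measure_itv/= lte_fin.
case: ifPn => [ax'|_]; last by rewrite mulr0 mulr_ge0// ltW.
rewrite -EFinB/= mulrAC ler_wpM2r// -mulrA ler_piMr//; first exact: ltW.
by rewrite mulrC ler_pdivrMr// mul1r; lra.
Qed.

Lemma first_order_extremum a b (F : R -> R -> R) (d : R -> R) x :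
  a <= x <= b -> first_order a b F d ->
  (forall eps, F 0 x <= F eps x) \/ (forall eps, F eps x <= F 0 x) -> d x = 0.
Proof.
move=> xab H ext; apply/eqP; apply: contraT => d0.
have nd0 : 0 < `|d x| by rewrite normr_gt0.
have [r r0 Hr] := H (`|d x| / 2) (divr_gt0 nd0 (@ltr0Sn R 1)).
have r2 : 0 < r / 2 by rewrite divr_gt0.
have r2r : r / 2 < r by lra.
(* The step s has the sign of d x. With tolerance half of |d x|, the value at s lies strictly above
   the value at 0 and the value at - s strictly below, so one of them contradicts extremality. *)
pose s := Num.sg (d x) * (r / 2).
have ns : `|s| = r / 2 by rewrite normrM normr_sg d0 mul1r gtr0_norm.
have sd : s * d x = (r / 2) * `|d x| by rewrite /s mulrAC mulrC -normrEsg.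
have := Hr s; rewrite ns => /(_ r2r x xab).
have := Hr (- s); rewrite normrN ns => /(_ r2r x xab).
rewrite mulNr sd opprK !ler_norml => /andP[h1 h2] /andP[h3 h4].
have pos : 0 < r / 2 * `|d x| by rewrite mulr_gt0.
case: ext => H'.
  have := H' (- s); set P := r / 2 * `|d x| in pos h1 h2 h3 h4 *.
  have E : `|d x| / 2 * (r / 2) = P / 2 by rewrite /P; field.
  rewrite E in h1 h2 h3 h4; lra.
have := H' s; set P := r / 2 * `|d x| in pos h1 h2 h3 h4 *.
have E : `|d x| / 2 * (r / 2) = P / 2 by rewrite /P; field.
rewrite E in h1 h2 h3 h4; lra.
Qed.

End first_order.

Lemma finite_radius (R : realType) m (Q : 'I_m -> R -> Prop) :
  (forall i, exists2 r, 0 < r & forall eps, `|eps| < r -> Q i eps) ->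
  exists2 r, 0 < r & forall eps, `|eps| < r -> forall i, Q i eps.
Proof.
move=> /(_ _)/cid2-/all_sig2[r r0 Hr].
exists (\big[Num.min/1]_i r i).
  by apply/bigmin_gtP; split.
by move=> eps /bigmin_gtP[_ He] i; apply: Hr; exact: He.
Qed.

(** * Chain rule along a compact curve, from partial derivatives *)

Section chain_rule.
Context {R : realType} (n : nat).
Implicit Types (i : 'I_n.+1) (u v : R) (D : set 'rV[R]_n.+1)
  (f : 'rV[R]_n.+1 -> R) (p q : 'rV[R]_n.+1).

(** Uniform continuity with only one of the two points confined to the compact set: the intermediate
    points of the mean value theorem used below lie near the curve K but not on it. *)
Lemma compact_uniform_continuous D K f : K `<=` D -> compact K ->
  {within D, continuous f} ->
  forall e, 0 < e -> exists2 r, 0 < r & forall p q, K p -> D q ->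
    (forall i, `|p 0 i - q 0 i| < r) -> `|f p - f q| < e.
Proof.
move=> KD cK /subspace_continuousP cf e e0.
have e20 : 0 < e / 2 by rewrite divr_gt0.
pose Q (r : R) p := forall q, D q -> (forall i, `|p 0 i - q 0 i| < r) -> `|f p - f q| < e.
have /near_covering_withinP H := (compact_near_coveringP K).1 cK.
have FF : Filter (0^'+ : set_system R) by exact: at_right_proper_filter.
suff : \forall r \near 0^'+, K `<=` Q r.
  move=> [r /= r0 Hr]; exists (r / 2); first by rewrite divr_gt0.
  move=> p q Kp Dq; apply: (Hr (r / 2)) => //=.
  - by rewrite sub0r normrN gtr0_norm ?divr_gt0// ltr_pdivrMr// ltr_pMr// ltr1n.
  - by rewrite divr_gt0.
apply: H => p Kp.
have /cvgrPdist_lt/(_ _ e20) := cf p (KD p Kp).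
move=> /nbhs_ballP[rho /= rho0 Hrho].
have r20 : 0 < rho / 2 by rewrite divr_gt0.
(* Half the radius goes to p' and half to q, so that both lie within rho of the centre p and are
   compared through [f p]. *)
exists (ball p (rho / 2), [set r | 0 < r < rho / 2]) => /=.
  split; first exact: nbhsx_ballx.
  exists (rho / 2) => //= r; rewrite /ball_/= sub0r normrN => rr r0.
  by rewrite r0 (le_lt_trans (ler_norm _) rr).
move=> [p' r] /= [pp' /andP[r0 rrho]] Kp' q Dq Hq.
have p'q : ball p' (rho / 2) q.
  by split => // i j; rewrite !ord1; exact: lt_trans (Hq j) rrho.
have pq : ball p rho q by rewrite (splitr rho); exact: ball_triangle pp' p'q.
have pp : ball p rho p'.
  by apply: le_ball pp'; rewrite ler_pdivrMr// ler_pMr// ler1n.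
have h1 := Hrho q pq Dq; have h2 := Hrho p' pp (KD _ Kp').
rewrite (splitr e) (_ : f p' - f q = (f p - f q) - (f p - f p')); last by ring.
by rewrite (le_lt_trans (ler_normB _ _))// ltrD.
Qed.

Lemma set_coord_id p i : set_coord p i (p 0 i) = p.
Proof. by apply/rowP => j; rewrite mxE; case: eqP => // ->. Qed.

Lemma set_coord_set p i u v : set_coord (set_coord p i u) i v = set_coord p i v.
Proof. by apply/rowP => j; rewrite !mxE; case: eqP. Qed.

Lemma slab_set_coord (a b : R) p i u : i != 0 -> slab a b p -> slab a b (set_coord p i u).
Proof. by move=> i0; rewrite /slab /= mxE eq_sym (negbTE i0). Qed.

(** The slab restricts only coordinate 0. In any other direction its slices are the whole line, so
    the relative partial derivative is a two-sided one. *)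
Lemma is_derive_partial (a b : R) f p i u : C1_on (slab a b) f -> slab a b p -> i != 0 ->
  is_derive u 1 (fun v => f (set_coord p i v)) (partial (slab a b) i f (set_coord p i u)).
Proof.
move=> [_ /(_ i)[hf _]] sp i0.
have := hf _ (slab_set_coord u i0 sp).
rewrite /has_partial /partial.
have -> : (fun v => f (set_coord (set_coord p i u) i v)) =
    (fun v => f (set_coord p i v)).
  by apply/funext => v; rewrite set_coord_set.
have -> : coord_slice (slab a b) i (set_coord p i u) = setT.
  apply/seteqP; split => // v _; rewrite /coord_slice /= set_coord_set.
  exact: slab_set_coord.
rewrite mxE eqxx => /is_deriv_on_deriv.
by apply: is_deriv_on_is_derive; exact: filterT.
Qed.

Lemma partial_MVT (a b : R) f p i u v : C1_on (slab a b) f -> slab a b p -> i != 0 ->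
  exists2 c, Num.min u v <= c <= Num.max u v &
  f (set_coord p i v) - f (set_coord p i u) =
    partial (slab a b) i f (set_coord p i c) * (v - u).
Proof.
move=> cf sp i0.
have dg w := is_derive_partial w cf sp i0.
have cg (u1 v1 : R) : {within `[u1, v1], continuous (fun w => f (set_coord p i w))}.
  by apply: derivable_within_continuous => w _; have [] := dg w.
have [uv|vu|->] := ltgtP u v; last first.
- by exists v; [rewrite lexx|rewrite !subrr mulr0].
- have [c cvu E] := MVT vu (fun w _ => dg w) (cg v u).
  exists c; last by rewrite -opprB E; ring.
  by move: cvu; rewrite in_itv/= => /andP[/ltW -> /ltW ->].
- have [c cvu E] := MVT uv (fun w _ => dg w) (cg u v).
  exists c => //.
  by move: cvu; rewrite in_itv/= => /andP[/ltW -> /ltW ->].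
Qed.

(** Staircase from p (at j = 0) to q (at j = n + 1) that changes one coordinate per step, so that
    the mean value theorem in one variable suffices. *)
Let mix p q (j : nat) : 'rV[R]_n.+1 := \row_i (if (i < j)%N then q 0 i else p 0 i).

Let mix_telescope f p q : p 0 0 = q 0 0 ->
  f q - f p = \sum_(i < n.+1 | i != 0) (f (mix p q i.+1) - f (mix p q i)).
Proof.
move=> pq0.
have -> : f q = f (mix p q n.+1).
  by congr f; apply/rowP => i; rewrite mxE ltn_ord.
have -> : f p = f (mix p q 0) by congr f; apply/rowP => i; rewrite mxE.
rewrite -(@telescope_sumr _ 0 n.+1 (fun j => f (mix p q j)))// big_mkord.
(* Coordinate 0 is common to p and q: the staircase never moves in the constrained direction of the
   slab. *)
rewrite (bigD1 ord0)//= [X in X + _](_ : _ = 0) ?add0r//.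
apply/eqP; rewrite subr_eq0; apply/eqP; congr f; apply/rowP => i; rewrite !mxE.
have [->//|i0] := eqVneq i ord0.
by rewrite ltnS leqn0 (negbTE (i0 : (i : nat) != 0%N)).
Qed.

Let mix_set p q (i : 'I_n.+1) : mix p q i.+1 = set_coord (mix p q i) i (q 0 i).
Proof.
apply/rowP => j; rewrite !mxE; have [->|ji] := eqVneq j i; first by rewrite ltnS leqnn.
by rewrite ltnS leq_eqVlt (negbTE (ji : (j : nat) != i)).
Qed.

Let mix_self p q (i : 'I_n.+1) : set_coord (mix p q i) i (p 0 i) = mix p q i.
Proof. by rewrite -[RHS](set_coord_id _ i) [in RHS]mxE ltnn. Qed.

(** On each step of the staircase the increment of f is a partial derivative at an intermediate
    point times a coordinate increment of order eps. Uniform continuity near the compact curve [P 0]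
    allows replacing that point by [P 0 x]. *)
Lemma first_order_comp (a b : R) f (P : R -> R -> 'rV[R]_n.+1) (d : 'I_n.+1 -> R -> R) M :
  C1_on (slab a b) f ->
  (forall eps x, a <= x <= b -> P eps x 0 0 = x) ->
  {within `[a, b], continuous (P 0)} ->
  (forall i, i != 0 -> first_order a b (fun eps x => P eps x 0 i) (d i)) ->
  (forall i x, a <= x <= b -> `|d i x| <= M) ->
  first_order a b (fun eps x => f (P eps x))
    (fun x => \sum_(i | i != 0) partial (slab a b) i f (P 0 x) * d i x).
Proof.
move=> cf P0 cP foP dM e e0.
have N0 : 0 < n.+1%:R :> R by rewrite ltr0n.
pose M1 := `|M| + 1.
have M10 : 0 < M1 by rewrite ltr_wpDl.
have Ps eps x : a <= x <= b -> slab a b (P eps x) by move=> xab; rewrite /slab /= P0.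
(* The expansion with tolerance 1, together with the bound M on the [d i], shows that the
   coordinates move by at most [M1] times |eps|. *)
have close : exists2 r, 0 < r & forall eps, `|eps| < r ->
    forall i, i != 0 -> forall x, a <= x <= b ->
    `|P eps x 0 i - P 0 x 0 i| <= `|eps| * M1.
  apply: finite_radius => i; have [->|i0] := eqVneq i 0.
    by exists 1.
  have [r r0 Hr] := foP i i0 1 ltr01; exists r => // eps er _ x xab.
  have := Hr eps er x xab; rewrite mul1r => h.
  rewrite (_ : P eps x 0 i - P 0 x 0 i =
    (P eps x 0 i - P 0 x 0 i - eps * d i x) + eps * d i x); last by ring.
  rewrite (le_trans (ler_normD _ _))// /M1 mulrDr mulr1 addrC lerD// normrM.
  by rewrite ler_wpM2l// (le_trans (dM i x xab)) ?ler_norm.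
have [r2 r20 Hr2] := close.
suff [r r0 Hr] : exists2 r, 0 < r & forall eps, `|eps| < r -> forall i, i != 0 ->
    forall x, a <= x <= b ->
    `|f (mix (P 0 x) (P eps x) i.+1) - f (mix (P 0 x) (P eps x) i) -
      eps * (partial (slab a b) i f (P 0 x) * d i x)| <= e / n.+1%:R * `|eps|.
  exists r => // eps er x xab.
  rewrite mix_telescope; last by rewrite !P0.
  rewrite mulr_sumr -sumrB (le_trans (ler_norm_sum _ _ _))//.
  apply: (@le_trans _ _ (\sum_(i < n.+1) e / n.+1%:R * `|eps|)).
    rewrite [leRHS](bigID (fun i => i != 0))/= ler_wpDr//.
      by apply: sumr_ge0 => i _; rewrite mulr_ge0// divr_ge0// ltW.
    by apply: ler_sum => i i0; exact: Hr.
  rewrite sumr_const card_ord -mulr_natr le_eqVlt; apply/orP; left; apply/eqP.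
  by field; rewrite gt_eqF.
apply: finite_radius => i; have [->|i0] := eqVneq i 0; first by exists 1.
set A := partial (slab a b) i f.
have cA : {within slab a b, continuous A} by have [_ /(_ i)[]] := cf.
have cAP : {within `[a, b], continuous (A \o P 0)}.
  by apply: (within_comp cP cA) => x; rewrite /= in_itv/=; exact: Ps.
have [B B0 HB] := within_itv_bounded cAP.
(* Each of the n + 1 coordinates has the share e / (n + 1), cut in two halves: one for the variation
   of the partial derivative, multiplied by [M1], and one for the expansion error of the coordinate,
   multiplied by at most B + 1. *)
have e10 : 0 < e / (2 * n.+1%:R * M1) by rewrite divr_gt0// !mulr_gt0.
have B10 : 0 < B + 1 by rewrite ltr_wpDl.
have e20 : 0 < e / (2 * n.+1%:R * (B + 1)) by rewrite divr_gt0// !mulr_gt0.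
pose K := [set P 0 x | x in `[a, b]].
have Kc : compact K by apply: continuous_compact => //; exact: segment_compact.
have KD : K `<=` slab a b by move=> _ [x + <-]; rewrite /= in_itv/=; exact: Ps.
have [r1 r10 Hr1] := compact_uniform_continuous KD Kc cA e10.
have [r3 r30 Hr3] := foP i i0 _ e20.
(* The radius r1 / M1 keeps every coordinate within r1, the range in which the partial derivative is
   controlled. *)
exists (Num.min (r1 / M1) (Num.min r2 r3)).
  by rewrite !lt_min r20 r30 divr_gt0.
move=> eps; rewrite !lt_min => /and3P[er1 er2 er3] _ x xab.
set p := P 0 x; set q := P eps x.
have sp : slab a b p by exact: Ps.
have sm : slab a b (mix p q i).
  by rewrite /slab /= mxE /p /q !P0// if_same.
have pq j : `|p 0 j - q 0 j| < r1.
  have [->|j0] := eqVneq j 0; first by rewrite /p /q !P0// subrr normr0.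
  rewrite distrC (le_lt_trans (Hr2 _ er2 _ j0 _ xab))// -ltr_pdivlMr//.
rewrite mix_set -{2}(mix_self p q i).
have [c cpq ->] := partial_MVT (p 0 i) (q 0 i) cf sm i0.
set pt := set_coord (mix p q i) i c.
have ppt j : `|p 0 j - pt 0 j| < r1.
  rewrite !mxE; have [->|ji] := eqVneq j i.
    apply: le_lt_trans (pq i); move: cpq; case: (leP (p 0 i) (q 0 i)) => h /andP[h1 h2].
      by rewrite ler0_norm ?ler0_norm; lra.
    by rewrite ger0_norm ?ger0_norm; lra.
  by case: ifPn => _; [exact: pq|rewrite subrr normr0].
have spt : slab a b pt by exact: slab_set_coord.
have Kp : K p by exists x => //=; rewrite in_itv.
have hA := Hr1 p pt Kp spt ppt.
rewrite -/A (_ : _ - _ = - (A p - A pt) * (q 0 i - p 0 i) +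
   A p * (q 0 i - p 0 i - eps * d i x)); last by ring.
rewrite (le_trans (ler_normD _ _))// !normrM normrN.
have -> : e / n.+1%:R * `|eps| = e / (2 * n.+1%:R * M1) * (`|eps| * M1) +
   (B + 1) * (e / (2 * n.+1%:R * (B + 1)) * `|eps|).
  by field; rewrite !gt_eqF.
apply: lerD.
  by apply: ler_pM => //; [exact: ltW|exact: Hr2].
apply: ler_pM => //; last exact: Hr3.
by rewrite (le_trans (HB x xab))// lerDl.
Qed.

End chain_rule.

(** * Primitives and the du Bois-Reymond lemma *)

Section primitives.
Context {R : realType}.
Notation mu := (@lebesgue_measure R).
Implicit Types (a b x : R) (f g : R -> R).

Lemma is_derive_Rintegral a x f : continuous f -> a < x ->
  is_derive x 1 (fun u => \int[mu]_(t in `[a, u]) f t) (f x).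
Proof.
move=> cf ax.
have xx1 : x < x + 1 by rewrite ltrDl.
have fi : mu.-integrable `[a, x + 1] (EFin \o f).
  by apply: within_itv_integrable; exact: continuous_within.
have [h1 h2] := continuous_FTC1_closed xx1 fi ax (cf x).
by split; [exact: h1|rewrite -derive1E; exact: h2].
Qed.

(** Since f vanishes up to a, the lower limit can be pushed below both a and x without changing the
    integral; x then lies strictly to the right of it, and the derivative is two-sided even at a. *)
Lemma is_derive_Rintegral0 a x f : continuous f -> (forall t, t <= a -> f t = 0) ->
  is_derive x 1 (fun u => \int[mu]_(t in `[a, u]) f t) (f x).
Proof.
move=> cf f0.
pose c := Num.min a x - 1.
have ca : c < a by rewrite /c; case: (leP a x) => ?; lra.
have cx : c < x by rewrite /c; case: (leP a x) => ?; lra.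
have -> : (fun u => \int[mu]_(t in `[a, u]) f t) = (fun u => \int[mu]_(t in `[c, u]) f t).
  apply/funext => u; rewrite Rintegral_mkcond [RHS]Rintegral_mkcond.
  apply: eq_Rintegral => t _; rewrite !patchE !mem_setE !in_itv/=.
  have [tu|tu] := leP t u; rewrite ?andbF// !andbT.
  have [at_|at_] := leP a t; first by rewrite (ltW (lt_le_trans ca at_)).
  by rewrite f0 ?if_same// ltW.
exact: is_derive_Rintegral.
Qed.

Lemma Rintegral_itv_split a c b f : a <= c <= b -> mu.-integrable `[a, b] (EFin \o f) ->
  \int[mu]_(t in `[a, b]) f t = \int[mu]_(t in `[a, c]) f t + \int[mu]_(t in `[c, b]) f t.
Proof.
move=> /andP[ac cb] fi.
have := Rintegral_itvB fi (_ : (BLeft a <= BRight c)%O) (_ : (BRight c <= BRight b)%O).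
rewrite !bnd_simp => /(_ ac cb) E.
rewrite -(@Rintegral_itv_obnd_cbnd _ c); first by rewrite -E addrC subrK.
apply: integrableS fi => //; apply: subset_itvr; by rewrite bnd_simp.
Qed.

(** The integrand is extended continuously beyond [a, b] and integrated from a - 1, which makes the
    endpoints interior; the integral over [u, b] is then F b - F u. *)
Lemma is_deriv_on_Rintegral_right a b x f : {within `[a, b], continuous f} -> a <= x <= b ->
  is_deriv_on `[a, b] (fun u => \int[mu]_(t in `[u, b]) f t) x (- f x).
Proof.
move=> cf xab; have /andP[ax xb] := xab; have ab := le_trans ax xb.
pose fc := f \o clip a b.
have cfc : continuous fc by exact: continuous_comp_clip.
pose F u := \int[mu]_(t in `[a - 1, u]) fc t.
have fcE t : a <= t <= b -> fc t = f t by move=> h; rewrite /fc /= clip_id.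
have dF : is_derive x 1 F (fc x) by apply: is_derive_Rintegral => //; lra.
have := is_deriv_onD (is_deriv_on_cst `[a, b] (F b) x)
  (is_deriv_onZ (k := -1) (is_derive_is_deriv_on `[a, b] dF)).
rewrite add0r mulN1r fcE//.
apply: is_deriv_on_eq; first by rewrite /= in_itv.
move=> u; rewrite inE/= in_itv/= => /andP[au ub].
have -> : \int[mu]_(t in `[u, b]) f t = \int[mu]_(t in `[u, b]) fc t.
  apply: eq_Rintegral => t; rewrite inE/= in_itv/= => /andP[? ?].
  by rewrite fcE//; apply/andP; split; lra.
rewrite /F (@Rintegral_itv_split (a - 1) u b); first by ring.
  by apply/andP; split; lra.
by apply: within_itv_integrable; exact: continuous_within.
Qed.

Lemma Rintegral_right_continuous a b f : a <= b -> {within `[a, b], continuous f} ->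
  {within `[a, b], continuous (fun x => \int[mu]_(t in `[x, b]) f t)}.
Proof.
move=> ab cf.
have fi := within_itv_integrable cf.
have cp := parameterized_integral_continuous ab fi.
apply: (@within_continuous_eq _ _ _ (fun x => \int[mu]_(t in `[a, b]) f t
   + (-1) * \int[mu]_(t in `[a, x]) f t)).
  move=> x xab; rewrite (Rintegral_itv_split xab fi); ring.
apply: (@within_continuousD _ _ _ `[a, b] (fun=> \int[mu]_(t in `[a, b]) f t)).
  exact: within_continuous_cst.
by apply: within_continuousM => //; exact: within_continuous_cst.
Qed.

(** By nonnegativity every integral over [u, b] is squeezed to 0, and f is minus the derivative of
    this function of u. *)
Lemma Rintegral_itv_eq0 a b f : {within `[a, b], continuous f} ->
  (forall x, a <= x <= b -> 0 <= f x) -> \int[mu]_(t in `[a, b]) f t = 0 ->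
  forall x, a < x < b -> f x = 0.
Proof.
move=> cf f0 I0.
pose F u := \int[mu]_(t in `[u, b]) f t.
have fi := within_itv_integrable cf.
have F0 u : a <= u <= b -> F u = 0.
  move=> uab; have /andP[au ub] := uab.
  have h1 : 0 <= \int[mu]_(t in `[a, u]) f t.
    apply: Rintegral_ge0 => t; rewrite /= in_itv/= => /andP[at_ tu].
    by apply: f0; rewrite at_ (le_trans tu).
  have h2 : 0 <= F u.
    apply: Rintegral_ge0 => t; rewrite /= in_itv/= => /andP[ut tb].
    by apply: f0; rewrite tb (le_trans au).
  have := Rintegral_itv_split uab fi; rewrite I0 -/(F u) => /esym/eqP.
  by rewrite paddr_eq0// => /andP[_ /eqP].
move=> x /andP[ax xb].
have xab : a <= x <= b by rewrite !ltW.
have := is_deriv_on_Rintegral_right cf xab.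
have := is_deriv_on_cst `[a, b] 0 x.
have PF : ProperFilter (within `[a, b] x^').
  by apply: within_itv_dnbhs_proper => //; exact: lt_trans xb.
have Sx : `[a, b]%classic x by rewrite /= in_itv.
move=> /(is_deriv_on_eq (G := F) Sx) H /(is_deriv_on_val PF).
rewrite (is_deriv_on_val PF (H _)); first by move=> /esym/eqP; rewrite oppr_eq0 => /eqP.
by move=> u; rewrite inE/= in_itv/= => /F0.
Qed.

Lemma continuous_eq_closure a b c f : a < b -> continuous f ->
  (forall x, a < x < b -> f x = c) -> forall x, a <= x <= b -> f x = c.
Proof.
move=> ab cf fc x /andP[ax xb]; apply/eqP; rewrite -subr_eq0; apply: contraT => fx.
have n0 : 0 < `|f x - c| by rewrite normr_gt0.
have /cvgrPdist_lt/(_ _ n0)[r /= r0 Hr] := cf x.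
have ba0 : 0 < b - a by rewrite subr_gt0.
(* Moving x towards the midpoint by a proportion s in ]0, 1/2] lands strictly inside the segment;
   the second bound makes the displacement smaller than r. *)
pose s := Num.min 2^-1 (r / (b - a)).
have s0 : 0 < s by rewrite lt_min invr_gt0 ltr0n divr_gt0.
have s1 : s <= 2^-1 by rewrite ge_min lexx.
have sr : s * (b - a) <= r by rewrite -ler_pdivlMr// ge_min lexx orbT.
pose t := x + s * ((a + b) / 2 - x).
have tab : a < t < b.
  rewrite /t; clear Hr cf fc fx n0 t sr.
  have e1 : 0 <= (1 - s) * (x - a) by rewrite mulr_ge0//; lra.
  have e2 : 0 <= (1 - s) * (b - x) by rewrite mulr_ge0//; lra.
  have e3 : 0 < s * ((b - a) / 2) by rewrite mulr_gt0// divr_gt0.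
  by apply/andP; split; lra.
suff xt : `|x - t| < r by have := Hr t xt; rewrite (fc t tab) ltxx.
rewrite /t opprD addNKr normrN normrM gtr0_norm//.
apply: (lt_le_trans _ sr); rewrite ltr_pM2l//.
by rewrite ltr_norml; clear -ab ax xb; apply/andP; split; lra.
Qed.

Lemma max0_continuous f : continuous f -> continuous (fun x => Num.max 0 (f x)).
Proof.
move=> cf x; apply: (@continuous_max R R (cst 0) f); first exact: cst_continuous.
exact: cf.
Qed.

(** A continuous weight, positive exactly on ]p, q[. *)
Let bump (p q t : R) := Num.max 0 ((t - p) * (q - t)).

Let bump_continuous p q : continuous (bump p q).
Proof.
apply: max0_continuous => t; apply: (@continuousM R R (fun t => t - p) (fun t => q - t)).
- by apply: (@continuousB _ _ _ id (cst p)) => //; exact: cst_continuous.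
- by apply: (@continuousB _ _ _ (cst q) id) => //; exact: cst_continuous.
Qed.

Let bump_ge0 p q t : 0 <= bump p q t.
Proof. by rewrite le_max lexx. Qed.

Let bump_gt0 p q t : p < t < q -> 0 < bump p q t.
Proof. by move=> /andP[pt tq]; rewrite lt_max mulr_gt0 ?orbT// subr_gt0. Qed.

Let bump_l p q t : p <= q -> t <= p -> bump p q t = 0.
Proof.
move=> pq tp; rewrite /bump max_l// mulr_le0_ge0// ?subr_le0 ?subr_ge0//.
exact: le_trans pq.
Qed.

Let bump_r p q t : p <= q -> q <= t -> bump p q t = 0.
Proof.
move=> pq qt; rewrite /bump max_l// mulr_ge0_le0// ?subr_le0 ?subr_ge0//.
exact: le_trans qt.
Qed.

(** The tested function is B + E to the left of m and B to the right, possibly with a jump at m. The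
    weights vanish at m, so the test function stays continuous. The only constraint on eta is a
    single integral over [a, b], which is why both pieces get the same constant. *)
Lemma du_bois_reymond a m b B E : a < m -> m < b ->
  {within `[a, b], continuous B} -> {within `[a, m], continuous E} ->
  (forall eta, continuous eta -> (forall t, t <= a -> eta t = 0) ->
    \int[mu]_(t in `[a, b]) eta t = 0 ->
    \int[mu]_(t in `[a, b]) (eta t * B t) + \int[mu]_(t in `[a, m]) (eta t * E t) = 0) ->
  exists c, (forall x, a <= x <= m -> B x + E x = c) /\
            (forall x, m <= x <= b -> B x = c).
Proof.
move=> am mb cB cE H.
have amW := ltW am; have mbW := ltW mb; have ab := lt_trans am mb; have abW := ltW ab.
pose B' := B \o clip a b; pose E' := E \o clip a m.
have cB' : continuous B' by exact: continuous_comp_clip.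
have cE' : continuous E' by exact: continuous_comp_clip.
pose Q1 t := B' t + E' t.
have cQ1 : continuous Q1 by move=> t; apply: continuousD; [exact: cB'|exact: cE'].
pose w1 := bump a m; pose w2 := bump m b.
have cM (f g : R -> R) : continuous f -> continuous g -> continuous (fun t => f t * g t).
  by move=> cf cg t; apply: continuousM; [exact: cf|exact: cg].
have cD (f g : R -> R) : continuous f -> continuous g -> continuous (fun t => f t + g t).
  by move=> cf cg t; apply: continuousD; [exact: cf|exact: cg].
have cC (k : R) : continuous (fun _ : R => k) by move=> t; exact: cst_continuous.
have int p q (f : R -> R) : continuous f -> mu.-integrable `[p, q] (EFin \o f).
  by move=> cf; apply: within_itv_integrable; exact: continuous_within.
have cw1 : continuous w1 by exact: bump_continuous.
have cw2 : continuous w2 by exact: bump_continuous.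
pose W := \int[mu]_(t in `[a, b]) (w1 t + w2 t).
have W0 : W != 0.
  apply/eqP => /Rintegral_itv_eq0 h.
  have : w1 ((a + m) / 2) + w2 ((a + m) / 2) = 0.
    apply: (h (continuous_within (cD _ _ cw1 cw2)) _ ((a + m) / 2)) => [x _|].
      by rewrite addr_ge0// bump_ge0.
    by apply/andP; split; lra.
  apply/eqP; rewrite gt_eqF// ltr_wpDr ?bump_ge0//; apply: bump_gt0.
  by apply/andP; split; lra.
(* The weighted mean of the tested function, chosen so that [eta] has integral 0. *)
pose c := (\int[mu]_(t in `[a, b]) (w1 t * Q1 t + w2 t * B' t)) / W.
(* With this eta the hypothesis says that the integral of
   w1 * (Q1 - c)^2 + w2 * (B' - c)^2 is 0. *)
pose eta t := w1 t * (Q1 t - c) + w2 t * (B' t - c).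
have ceta : continuous eta by apply: (@cD); apply: (@cM) => //; apply: (@cD).
have eta0 t : t <= a -> eta t = 0.
  by move=> ta; rewrite /eta /w1 /w2 !bump_l ?mul0r ?addr0// (le_trans ta).
have eta1 : \int[mu]_(t in `[a, b]) eta t = 0.
  transitivity (\int[mu]_(t in `[a, b]) ((w1 t * Q1 t + w2 t * B' t) - c * (w1 t + w2 t))).
    by apply: eq_Rintegral => t _; rewrite /eta; ring.
  rewrite RintegralB ?RintegralZl//.
  - by rewrite -/W /c divfK ?subrr.
  - by apply: (@int); exact: (@cD).
  - by apply: (@int); apply: (@cD); exact: (@cM).
  - by apply: (@int); apply: (@cM) => //; exact: (@cD).
pose D t := w1 t * (Q1 t - c) ^+ 2 + w2 t * (B' t - c) ^+ 2.
have cDD : continuous D.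
  rewrite /D; apply: (@cD); apply: (@cM) => //; under eq_fun do rewrite expr2;
    by apply: (@cM); apply: (@cD).
have D0 : \int[mu]_(t in `[a, b]) D t = 0.
  have cwE : continuous (fun t => w1 t * (Q1 t - c) * E' t).
    by apply: (@cM) => //; apply: (@cM) => //; exact: (@cD).
  have E1 : \int[mu]_(t in `[a, m]) (eta t * E t) =
      \int[mu]_(t in `[a, b]) (w1 t * (Q1 t - c) * E' t).
    rewrite (@Rintegral_itv_split a m b); [|by rewrite amW|exact: (@int)].
    rewrite [X in _ = _ + X](_ : _ = 0) ?addr0.
      apply: eq_Rintegral => t; rewrite inE/= in_itv/= => tam.
      rewrite /eta /w2 bump_l ?mul0r ?addr0//; last by case/andP: tam.
      by rewrite /E' /= clip_id.
    transitivity (\int[mu]_(t in `[m, b]) (cst 0 t)).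
      apply: eq_Rintegral => t; rewrite inE/= in_itv/= => /andP[mt tb].
      by rewrite /w1 bump_r ?mul0r.
    by rewrite Rintegral_cst// mul0r.
  have E2 : \int[mu]_(t in `[a, b]) (eta t * B t) = \int[mu]_(t in `[a, b]) (eta t * B' t).
    by apply: eq_Rintegral => t; rewrite inE/= in_itv/= => tab; rewrite /B' /= clip_id.
  have := H eta ceta eta0 eta1; rewrite E1 E2 -RintegralD//; last 2 first.
  - by apply: (@int); exact: (@cM).
  - exact: (@int).
  (* Subtracting c times the vanishing integral of [eta] completes the squares. *)
  move=> H0; rewrite -[RHS](subrr 0) -{1}H0 -[X in _ - X](mulr0 c) -eta1.
  rewrite -RintegralZl//; last exact: (@int).
  rewrite -RintegralB//; last 2 first.
  - by apply: (@int); apply: (@cD) => //; exact: (@cM).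
  - by apply: (@int); exact: (@cM).
  by apply: eq_Rintegral => t _; rewrite /D /eta /Q1; ring.
have DE := Rintegral_itv_eq0 (continuous_within cDD) _ D0.
have {}DE x : a < x < b -> D x = 0.
  by apply: DE => t _; apply: addr_ge0; apply: mulr_ge0; rewrite ?bump_ge0 ?sqr_ge0.
exists c; split => x xx.
- have -> : B x + E x = Q1 x.
    rewrite /Q1 /B' /E' /= !clip_id//; by case/andP: xx => -> /le_trans ->.
  apply: (continuous_eq_closure am cQ1) => // t tam.
  have := DE t; rewrite /D /w2 bump_l ?mul0r ?addr0; [|by []|by case/andP: tam => _ /ltW].
  case/andP: (tam) => at_ tm; rewrite at_ (lt_trans tm mb) => /(_ isT)/eqP.
  rewrite mulf_eq0 gt_eqF; last exact: bump_gt0.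
  by rewrite /= sqrf_eq0 subr_eq0 => /eqP.
- have -> : B x = B' x.
    rewrite /B' /= !clip_id//; by case/andP: xx => /(le_trans amW) -> ->.
  apply: (continuous_eq_closure mb cB') => // t tam.
  have := DE t; rewrite /D /w1 bump_r ?mul0r ?add0r; [|by []|by case/andP: tam => /ltW].
  case/andP: (tam) => mt tb; rewrite tb (lt_trans am mt) => /(_ isT)/eqP.
  rewrite mulf_eq0 gt_eqF; last exact: bump_gt0.
  by rewrite /= sqrf_eq0 subr_eq0 => /eqP.
Qed.

End primitives.

(** * Variation of an admissible function *)

Section curves.
Context {R : realType}.
Notation mu := (@lebesgue_measure R).

Lemma within_continuous_row n (A : set R) (P : R -> 'rV[R]_n) :
  (forall i, {within A, continuous (fun x => P x 0 i)}) -> {within A, continuous P}.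
Proof.
move=> cP; apply/subspace_continuousP => x Ax N [Q nQ QN].
have H : within A (nbhs x) (fun x' => forall j, Q 0 j (P x' 0 j)).
  apply: (@filter_forall _ _ (fun j x' => Q 0 j (P x' 0 j)) (within A (nbhs x)) _ _) => j.
  by have /subspace_continuousP/(_ x Ax) := cP j; apply; exact: nQ.
apply: (filterS _ H : within A (nbhs x) _) => x' Hx'.
by apply: QN => i j; rewrite ord1.
Qed.

Lemma derivable_on_continuous (S : set R) (F : R -> R) :
  (forall x, S x -> derivable_on S F x) -> {within S, continuous F}.
Proof.
move=> dF; apply/subspace_continuousP => x Sx.
have /is_deriv_on_deriv/cvgrPdist_lt/(_ _ ltr01)[r /= r0 Hr] := dF x Sx.
set d := deriv_on S F x in Hr.
have d10 : 0 < `|d| + 1 by rewrite ltr_wpDl.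
apply/cvgrPdist_lt => e e0.
exists (Num.min r (e / (`|d| + 1))); first by rewrite /= lt_min r0 divr_gt0.
move=> u /=; rewrite lt_min => /andP[ur ue] Su.
have [->|ux] := eqVneq u x; first by rewrite subrr normr0.
have := Hr u ur ux Su.
have ux0 : u - x != 0 by rewrite subr_eq0.
have -> : F x - F u = diff_quot F x u * (x - u).
  by rewrite /diff_quot -opprB -[x - u]opprB mulrN divfK.
move=> hd; rewrite normrM.
have hq : `|diff_quot F x u| < `|d| + 1.
  rewrite (_ : diff_quot F x u = d - (d - diff_quot F x u)); last by ring.
  by rewrite (le_lt_trans (ler_normB _ _))// ltrD2l.
apply: (@le_lt_trans _ _ ((`|d| + 1) * `|x - u|)); first by rewrite ler_wpM2r// ltW.
by rewrite mulrC -ltr_pdivlMr.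
Qed.

Lemma sum_ord4 (F : 'I_4 -> R) :
  \sum_(i | i != 0) F i = F arg_y + F arg_v + F arg_w.
Proof.
rewrite big_mkcond !big_ord_recl big_ord0 /= add0r addr0 !addrA.
by congr (F _ + F _ + F _); apply/val_inj.
Qed.

Lemma sum_ord7 (F : 'I_7 -> R) :
  \sum_(i | i != 0) F i = F arg_y + F arg_v + F arg_w + F arg_z + F arg_ytau + F arg_vtau.
Proof.
rewrite big_mkcond !big_ord_recl big_ord0 /= add0r addr0 !addrA.
by congr (F _ + F _ + F _ + F _ + F _ + F _); apply/val_inj.
Qed.

Lemma first_order_comp_continuous n (a b : R) f (P : R -> R -> 'rV[R]_n.+1)
    (d : 'I_n.+1 -> R -> R) :
  C1_on (slab a b) f ->
  (forall eps x, a <= x <= b -> P eps x 0 0 = x) ->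
  {within `[a, b], continuous (P 0)} ->
  (forall i, i != 0 -> first_order a b (fun eps x => P eps x 0 i) (d i)) ->
  (forall i, {within `[a, b], continuous (d i)}) ->
  first_order a b (fun eps x => f (P eps x))
    (fun x => \sum_(i | i != 0) partial (slab a b) i f (P 0 x) * d i x).
Proof.
move=> cf P0 cP foP cd.
have /(_ _)/cid2-/all_sig2[M M0 HM] := fun i => within_itv_bounded (cd i).
apply: (@first_order_comp _ _ _ _ _ _ _ (\sum_i M i)) => // i x xab.
rewrite (le_trans (HM i x xab))// (bigD1 i)//= lerDl.
by apply: sumr_ge0 => j _; exact: M0.
Qed.

Lemma curly0 (alpha beta a : R) y x : curly alpha beta a y x 0 0 = x.
Proof. by rewrite mxE. Qed.

Lemma bracket0 (alpha beta tau a b : R) l y x : bracket alpha beta tau a b l y x 0 0 = x.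
Proof. by rewrite mxE. Qed.

Lemma within_continuous_curly (alpha beta a b : R) y :
  {within `[a, b], continuous y} ->
  {within `[a, b], continuous (caputo alpha a y)} ->
  {within `[a, b], continuous (left_frac_int beta a y)} ->
  {within `[a, b], continuous (curly alpha beta a y)}.
Proof.
move=> cy cD cI; apply: within_continuous_row => i.
under [X in continuous X]eq_fun do rewrite mxE.
case: i => [[|[|[|[|//]]]] ?] //=.
by apply: continuous_subspaceT => x.
Qed.

Lemma within_continuous_along n (a b : R) (p : R -> 'rV[R]_n.+1) (f : 'rV[R]_n.+1 -> R) :
  (forall x, a <= x <= b -> p x 0 0 = x) -> {within `[a, b], continuous p} ->
  {within slab a b, continuous f} -> {within `[a, b], continuous (f \o p)}.
Proof.
move=> p0 cp cf; apply: (within_comp cp cf) => x; rewrite /= in_itv/= => xab.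
by rewrite /slab /= p0.
Qed.

Lemma admissible_continuous_curly (alpha beta tau a b : R) phi yb y : 0 <= tau ->
  admissible alpha beta tau a b phi yb y ->
  {within `[a, b], continuous (curly alpha beta a y)}.
Proof.
move=> tau0 [[dy _] [_ cD] [_ cI] _ _]; apply: within_continuous_curly => //.
by apply: within_itv_sub (derivable_on_continuous dy); lra.
Qed.

Lemma within_continuous_bracket (alpha beta tau a b : R) phi yb l y :
  a <= b -> 0 <= tau -> C1_on (slab a b) l -> admissible alpha beta tau a b phi yb y ->
  {within `[a, b], continuous (bracket alpha beta tau a b l y)}.
Proof.
move=> ab tau0 [cl _] adm; have [[dy cy'] [_ cD] [_ cI] _ _] := adm.
have cy := derivable_on_continuous dy.
have cyab : {within `[a, b], continuous y} by apply: within_itv_sub cy; lra.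
have ccu := admissible_continuous_curly tau0 adm.
have clc : {within `[a, b], continuous (l \o curly alpha beta a y)}.
  by apply: within_continuous_along => // x _; exact: curly0.
have shift (f : R -> R) : {within `[a - tau, b], continuous f} ->
    {within `[a, b], continuous (fun x => f (x - tau))}.
  move=> cf; have := within_itv_shift (c := - tau) cf; rewrite !opprK subrK.
  by apply: within_itv_sub => //; lra.
apply: within_continuous_row => i.
under [X in continuous X]eq_fun do rewrite mxE.
case: i => [[|[|[|[|[|[|[|//]]]]]]] ?] //=.
- by apply: continuous_subspaceT => x.
- exact: (parameterized_integral_continuous ab (within_itv_integrable clc)).
- exact: shift.
- exact: shift.
Qed.

End curves.

Section variation.
Context {R : realType} (alpha beta tau a b : R).
Context (halpha : 0 < alpha < 1) (hbeta : 0 < beta) (htau : 0 < tau < b - a).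
Context (eta : R -> R) (ceta : continuous eta) (eta0 : forall t, t <= a -> eta t = 0).
Notation mu := (@lebesgue_measure R).
Implicit Types x t eps : R.

Let tau0 : 0 < tau. Proof. by case/andP: htau. Qed.
Let ab : a < b. Proof. by case/andP: htau; lra. Qed.
Let alphaN1 : -1 < - alpha. Proof. by case/andP: halpha; lra. Qed.
Let betaN1 : -1 < beta - 1. Proof. by have := hbeta; lra. Qed.

Definition primitive (x : R) := \int[mu]_(t in `[a, x]) eta t.
Local Notation h := primitive.

Lemma is_derive_primitive x : is_derive x 1 h (eta x).
Proof. exact: is_derive_Rintegral0. Qed.

(** As the two-sided derivative is eta everywhere, the Caputo derivative of h is a left fractional
    integral of a continuous function, with no trouble at a. *)
Lemma derive1_primitive : derive1 h = eta.
Proof. by apply/funext => x; rewrite derive1E; have [] := is_derive_primitive x. Qed.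

Lemma continuous_primitive : continuous h.
Proof.
move=> x; apply/differentiable_continuous/derivable1_diffP.
by have [] := is_derive_primitive x.
Qed.

Lemma primitive_le x : x <= a -> h x = 0.
Proof.
move=> xa; transitivity (\int[mu]_(t in `[a, x]) (cst 0 t)).
  by apply: eq_Rintegral => t; rewrite inE/= in_itv/= => /andP[? ?]; rewrite eta0//; lra.
by rewrite Rintegral_cst// mul0r.
Qed.

Lemma within_caputo_primitive : {within `[a, b], continuous (caputo alpha a h)}.
Proof.
rewrite /caputo derive1_primitive; apply: within_continuousM.
  exact: within_continuous_cst.
by apply: left_kernel_continuous; [exact: alphaN1|exact: ltW ab|exact: continuous_within].
Qed.

Lemma within_left_frac_int_primitive : {within `[a, b], continuous (left_frac_int beta a h)}.
Proof.
apply: within_continuousM; first exact: within_continuous_cst.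
apply: left_kernel_continuous; [exact: betaN1|exact: ltW ab|].
exact/continuous_within/continuous_primitive.
Qed.

Context (phi : R -> R) (yb : R) (y : R -> R).
Context (hy : admissible alpha beta tau a b phi yb y).

Definition varied eps x := y x + eps * h x.

Lemma varied0 : varied 0 = y.
Proof. by apply/funext => x; rewrite /varied mul0r addr0. Qed.

Lemma is_deriv_on_varied eps x : a - tau <= x <= b ->
  is_deriv_on `[a - tau, b] (varied eps) x (deriv_on `[a - tau, b] y x + eps * eta x).
Proof.
move=> xab; have [[dy _] _ _ _ _] := hy.
apply: is_deriv_onD; first by apply: is_deriv_on_deriv; apply: dy; rewrite /= in_itv.
by apply: is_deriv_onZ; apply: is_derive_is_deriv_on; exact: is_derive_primitive.
Qed.

Lemma deriv_on_varied eps x : a - tau <= x <= b ->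
  deriv_on `[a - tau, b] (varied eps) x = deriv_on `[a - tau, b] y x + eps * eta x.
Proof.
move=> xab; apply: is_deriv_on_val; last exact: is_deriv_on_varied.
by apply: within_itv_dnbhs_proper => //; have := tau0; have := ab; lra.
Qed.

Lemma derive1_deriv_on f x : a - tau < x < b -> derivable_on `[a - tau, b] f x ->
  derive1 f x = deriv_on `[a - tau, b] f x.
Proof.
move=> /andP[ax xb] df; rewrite derive1E.
have N : nbhs x `[a - tau, b]%classic.
  apply: (filterS (@subset_itv_oo_cc _ _ _ _)).
  by apply: open_nbhs_nbhs; split; [exact: itv_open|rewrite /= in_itv/= ax].
by have [] := is_deriv_on_is_derive N (is_deriv_on_deriv df).
Qed.

(** Because tau > 0, the point a is interior to the domain [a - tau, b], where the two-sided
    derivative agrees with the one along the domain; only b has to be left out. *)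
Lemma derive1_varied eps x : a <= x < b -> derive1 (varied eps) x = derive1 y x + eps * eta x.
Proof.
move=> /andP[ax xb]; have [[dy _] _ _ _ _] := hy.
have xi : a - tau < x < b by rewrite xb andbT; have := tau0; lra.
have xc : a - tau <= x <= b by case/andP: xi => ? ?; rewrite !ltW.
have dyx : derivable_on `[a - tau, b] y x by apply: dy; rewrite /= in_itv.
have dvx := is_deriv_on_derivable (is_deriv_on_varied (eps := eps) xc).
by rewrite (derive1_deriv_on xi dyx) (derive1_deriv_on xi dvx) deriv_on_varied.
Qed.

(* At t = x = b the two-sided derivative is uncontrolled, but there the kernel
   0 `^ (- alpha) is 0. *)
Lemma left_integrand_varied eps x t : a <= x <= b -> a <= t <= x ->
  left_integrand (- alpha) x (derive1 (varied eps)) t =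
  left_integrand (- alpha) x (derive1 y) t + eps * left_integrand (- alpha) x (derive1 h) t.
Proof.
move=> /andP[ax xb] /andP[at_ tx]; rewrite /left_integrand derive1_primitive.
have [->|tnx] := eqVneq t x.
  rewrite subrr powR0 ?mul0r ?mulr0 ?addr0// oppr_eq0.
  by case/andP: halpha => /lt0r_neq0.
rewrite derive1_varied; first by ring.
by rewrite at_ (lt_le_trans _ xb)// lt_neqAle tnx.
Qed.

Let integrable_left_primitive (x : R) : a <= x <= b ->
  mu.-integrable `[a, x] (EFin \o left_integrand (- alpha) x (derive1 h)).
Proof.
move=> xab; rewrite derive1_primitive.
by apply: (left_kernel_integrable alphaN1 xab); exact: continuous_within.
Qed.

Let integrable_left_frac_primitive (x : R) : a <= x <= b ->
  mu.-integrable `[a, x] (EFin \o left_integrand (beta - 1) x h).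
Proof.
move=> xab; apply: (left_kernel_integrable betaN1 xab).
exact/continuous_within/continuous_primitive.
Qed.

Lemma caputo_varied eps x : a <= x <= b ->
  caputo alpha a (varied eps) x = caputo alpha a y x + eps * caputo alpha a h x.
Proof.
move=> xab; have [_ [iy _] _ _ _] := hy.
rewrite /caputo mulrCA -mulrDr; congr (_ * _).
rewrite -RintegralZl//; last exact: integrable_left_primitive.
rewrite -RintegralD//; last 2 first.
- exact: iy.
- exact: (integrableZl _ eps (integrable_left_primitive xab)).
by apply: eq_Rintegral => t; rewrite inE/= in_itv/=; exact: left_integrand_varied.
Qed.

Lemma left_frac_int_varied eps x : a <= x <= b ->
  left_frac_int beta a (varied eps) x =
  left_frac_int beta a y x + eps * left_frac_int beta a h x.
Proof.
move=> xab; have [_ _ [iy _] _ _] := hy.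
rewrite /left_frac_int mulrCA -mulrDr; congr (_ * _).
rewrite -RintegralZl//; last exact: integrable_left_frac_primitive.
rewrite -RintegralD//; last 2 first.
- exact: iy.
- exact: (integrableZl _ eps (integrable_left_frac_primitive xab)).
by apply: eq_Rintegral => t _; rewrite /left_integrand /varied; ring.
Qed.

Lemma within_continuous_affine (p q eps : R) (f g : R -> R) :
  {within `[p, q], continuous f} -> {within `[p, q], continuous g} ->
  {within `[p, q], continuous (fun x => f x + eps * g x)}.
Proof.
move=> cf cg; apply: (@within_continuousD _ _ _ _ f (fun x => eps * g x)) => //.
by apply: within_continuousM => //; exact: within_continuous_cst.
Qed.

Lemma admissible_varied eps : h b = 0 -> admissible alpha beta tau a b phi yb (varied eps).
Proof.
move=> hb; have [[dy cdy] [iD cD] [iI cI] yby yphi] := hy; split.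
- split=> [x|].
    rewrite /= in_itv/= => xab.
    exact: is_deriv_on_derivable (is_deriv_on_varied xab).
  apply: (@within_continuous_eq _ _ _ (fun x => deriv_on `[a - tau, b] y x + eps * eta x)).
    by move=> x xab; rewrite deriv_on_varied.
  by apply: within_continuous_affine => //; exact: continuous_within.
- split=> [x xab|].
    apply: (@eq_integrable _ _ _ mu _ _ (EFin \o (fun t =>
      left_integrand (- alpha) x (derive1 y) t +
      eps * left_integrand (- alpha) x (derive1 h) t))) => //.
      by move=> t; rewrite inE/= in_itv/= => tax; rewrite left_integrand_varied.
    exact: (integrableD _ (iD x xab)
      (integrableZl _ eps (integrable_left_primitive xab))).
  apply: (@within_continuous_eq _ _ _
    (fun x => caputo alpha a y x + eps * caputo alpha a h x)).
    by move=> x xab; rewrite caputo_varied.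
  exact: (within_continuous_affine (eps := eps) cD within_caputo_primitive).
- split=> [x xab|].
    apply: (@eq_integrable _ _ _ mu _ _ (EFin \o (fun t => left_integrand (beta - 1) x y t
      + eps * left_integrand (beta - 1) x h t))) => //.
      by move=> t _; congr EFin; rewrite /left_integrand /varied; ring.
    exact: (integrableD _ (iI x xab)
      (integrableZl _ eps (integrable_left_frac_primitive xab))).
  apply: (@within_continuous_eq _ _ _
    (fun x => left_frac_int beta a y x + eps * left_frac_int beta a h x)).
    by move=> x xab; rewrite left_frac_int_varied.
  exact: (within_continuous_affine (eps := eps) cI within_left_frac_int_primitive).
- by rewrite /varied hb mulr0 addr0.
- move=> x /[dup] /yphi <- /andP[_ xa].
  by rewrite /varied primitive_le// mulr0 addr0.
Qed.

End variation.

Section first_variation.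
Context {R : realType} (alpha beta tau a b : R).
Context (halpha : 0 < alpha < 1) (hbeta : 0 < beta) (htau : 0 < tau < b - a).
Context (eta : R -> R) (ceta : continuous eta) (eta0 : forall t, t <= a -> eta t = 0).
Context (phi : R -> R) (yb : R) (y : R -> R).
Context (hy : admissible alpha beta tau a b phi yb y).
Context (L : 'rV[R]_7 -> R) (l : 'rV[R]_4 -> R).
Context (hL : C1_on (slab a b) L) (hl : C1_on (slab a b) l).
Notation mu := (@lebesgue_measure R).
Implicit Types x t eps : R.
Local Notation h := (primitive a eta).
Context (hb : h b = 0).

Let tau0 : 0 < tau. Proof. by case/andP: htau. Qed.
Let ab : a < b. Proof. by case/andP: htau; lra. Qed.

Let cu eps := curly alpha beta a (varied a eta y eps).
Let br eps := bracket alpha beta tau a b l (varied a eta y eps).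

(** Derivatives in eps of the coordinates of the varied curve, which are all affine in eps; the
    entry 0 belongs to x, which is not varied. *)
Definition dcurly (i : 'I_4) x : R :=
  [:: 0; h x; caputo alpha a h x; left_frac_int beta a h x]`_i.

(** Variation of z, the one coordinate of [bracket] that need not be affine in eps: it requires a
    chain rule for l before the one for L. *)
Definition dzfun x : R :=
  \int[mu]_(t in `[a, x]) (\sum_(i | i != 0)
     partial (slab a b) i l (curly alpha beta a y t) * dcurly i t).

Definition dbracket (i : 'I_7) x : R :=
  [:: 0; h x; caputo alpha a h x; left_frac_int beta a h x; dzfun x;
      h (x - tau); eta (x - tau)]`_i.

Let hadm eps : admissible alpha beta tau a b phi yb (varied a eta y eps).
Proof. exact: (admissible_varied halpha hbeta htau ceta eta0 hy eps hb). Qed.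

Let cu_continuous eps : {within `[a, b], continuous (cu eps)}.
Proof.
exact: (admissible_continuous_curly (ltW tau0) (hadm eps)).
Qed.

Let br_continuous eps : {within `[a, b], continuous (br eps)}.
Proof. exact: (within_continuous_bracket (ltW ab) (ltW tau0) hl (hadm eps)). Qed.

Let ch : continuous h. Proof. exact: continuous_primitive. Qed.

Lemma within_continuous_dcurly i : {within `[a, b], continuous (dcurly i)}.
Proof.
rewrite /dcurly; case: i => [[|[|[|[|//]]]] ?] /=.
- exact: within_continuous_cst.
- exact: continuous_within.
- exact: (within_caputo_primitive halpha htau ceta eta0).
- exact: (within_left_frac_int_primitive hbeta htau ceta eta0).
Qed.

Lemma within_continuous_partial_curly i :
  {within `[a, b], continuous (fun x => partial (slab a b) i l (curly alpha beta a y x))}.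
Proof.
have ccu := admissible_continuous_curly (ltW tau0) hy.
apply: (within_continuous_along _ ccu) => [x _|]; first exact: curly0.
by have [_ /(_ i)[]] := hl.
Qed.

Lemma within_continuous_partial_bracket i :
  {within `[a, b], continuous
    (fun x => partial (slab a b) i L (bracket alpha beta tau a b l y x))}.
Proof.
have cbr := within_continuous_bracket (ltW ab) (ltW tau0) hl hy.
apply: (within_continuous_along _ cbr) => [x _|]; first exact: bracket0.
by have [_ /(_ i)[]] := hL.
Qed.

Let within_continuous_sum n (F : 'I_n.+1 -> R -> R) :
  (forall i, {within `[a, b], continuous (F i)}) ->
  {within `[a, b], continuous (fun x => \sum_(i | i != 0) F i x)}.
Proof.
move=> cF; rewrite (_ : (fun x => _) = \sum_(i | i != 0) F i); last first.
  by apply/funext => x; rewrite fct_sumE.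
elim/big_ind : _ => [|f g cf cg|i _]; last exact: cF.
  exact: within_continuous_cst.
exact: within_continuousD.
Qed.

Let cdl : {within `[a, b], continuous (fun t => \sum_(i | i != 0)
     partial (slab a b) i l (curly alpha beta a y t) * dcurly i t)}.
Proof.
apply: (within_continuous_sum (F := fun i t =>
  partial (slab a b) i l (curly alpha beta a y t) * dcurly i t)) => i.
apply: within_continuousM; first exact: within_continuous_partial_curly.
exact: within_continuous_dcurly.
Qed.

Lemma within_continuous_dzfun : {within `[a, b], continuous dzfun}.
Proof. exact: (parameterized_integral_continuous (ltW ab) (within_itv_integrable cdl)). Qed.

Lemma within_continuous_dbracket i : {within `[a, b], continuous (dbracket i)}.
Proof.
rewrite /dbracket; case: i => [[|[|[|[|[|[|[|//]]]]]]] ?] /=.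
- exact: within_continuous_cst.
- exact: continuous_within.
- exact: (within_caputo_primitive halpha htau ceta eta0).
- exact: (within_left_frac_int_primitive hbeta htau ceta eta0).
- exact: within_continuous_dzfun.
- exact: within_continuous_delay.
- exact: within_continuous_delay.
Qed.

Lemma first_order_l : first_order a b (fun eps x => l (cu eps x))
  (fun t => \sum_(i | i != 0) partial (slab a b) i l (curly alpha beta a y t) * dcurly i t).
Proof.
have := @first_order_comp_continuous R _ a b l cu dcurly hl.
rewrite /cu varied0; apply.
- by move=> eps x _; rewrite curly0.
- by have := @cu_continuous 0; rewrite /cu varied0.
- move=> i _; apply: (@first_order_linear _ _ _ (fun x => curly alpha beta a y x 0 i)).
  move=> eps x xab; rewrite !mxE /dcurly.
  case: i => [[|[|[|[|//]]]] ?] //=.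
  + by rewrite mulr0 addr0.
  + exact: (caputo_varied halpha htau ceta eta0 hy).
  + exact: (left_frac_int_varied hbeta ceta eta0 hy).
- exact: within_continuous_dcurly.
Qed.

Lemma first_order_z : first_order a b
  (fun eps x => zfun alpha beta a l (varied a eta y eps) x) dzfun.
Proof.
apply: first_order_Rintegral first_order_l => [eps|]; last exact: within_itv_integrable.
apply: within_itv_integrable; apply: (within_continuous_along _ (@cu_continuous eps)).
  by move=> x _; exact: curly0.
by have [] := hl.
Qed.

Lemma first_order_L : first_order a b (fun eps x => L (br eps x))
  (fun x => \sum_(i | i != 0)
    partial (slab a b) i L (bracket alpha beta tau a b l y x) * dbracket i x).
Proof.
have := @first_order_comp_continuous R _ a b L br dbracket hL.
rewrite /br varied0; apply.
- by move=> eps x _; rewrite bracket0.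
- by have := @br_continuous 0; rewrite /br varied0.
- move=> i _.
  have [iz|iz] := eqVneq i arg_z.
    subst i; have := first_order_z; congr (first_order a b _ _).
    by apply/funext => eps; apply/funext => x; rewrite mxE.
  apply: (@first_order_linear _ _ _ (fun x => bracket alpha beta tau a b l y x 0 i)).
  move=> eps x xab; rewrite !mxE /dbracket.
  have xtau : a - tau <= x - tau <= b by case/andP: xab => ? ?; have := tau0; lra.
  case: i iz => [[|[|[|[|[|[|[|//]]]]]]] ?] //= iz.
  + by rewrite mulr0 addr0.
  + exact: (caputo_varied halpha htau ceta eta0 hy).
  + exact: (left_frac_int_varied hbeta ceta eta0 hy).
  + exact: (deriv_on_varied htau ceta eta0 hy).
- exact: within_continuous_dbracket.
Qed.

Lemma first_variation :
  (forall y1, admissible alpha beta tau a b phi yb y1 ->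
     J alpha beta tau a b L l y <= J alpha beta tau a b L l y1) \/
  (forall y1, admissible alpha beta tau a b phi yb y1 ->
     J alpha beta tau a b L l y1 <= J alpha beta tau a b L l y) ->
  \int[mu]_(x in `[a, b]) (\sum_(i | i != 0)
    partial (slab a b) i L (bracket alpha beta tau a b l y x) * dbracket i x) = 0.
Proof.
move=> hext.
have iL eps : mu.-integrable `[a, b] (EFin \o (fun x => L (br eps x))).
  apply: within_itv_integrable; apply: (within_continuous_along _ (@br_continuous eps)).
    by move=> x _; exact: bracket0.
  by have [] := hL.
have id : mu.-integrable `[a, b] (EFin \o (fun x => \sum_(i | i != 0)
    partial (slab a b) i L (bracket alpha beta tau a b l y x) * dbracket i x)).
  apply: within_itv_integrable.
  apply: (within_continuous_sum (F := fun i x =>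
    partial (slab a b) i L (bracket alpha beta tau a b l y x) * dbracket i x)) => i.
  apply: within_continuousM; first exact: within_continuous_partial_bracket.
  exact: within_continuous_dbracket.
have bab : a <= b <= b by rewrite lexx ltW.
(* The primitive of the integrand is expanded for all upper limits x; its value at x = b is the
   functional. *)
apply: (first_order_extremum bab (first_order_Rintegral iL id first_order_L)).
have J0 : \int[mu]_(t in `[a, b]) L (br 0 t) = J alpha beta tau a b L l y.
  by rewrite /br varied0.
by rewrite J0; case: hext => H; [left|right] => eps; exact: H.
Qed.

End first_variation.

(** * Integrated Euler-Lagrange equations *)

Section adjoint.
Context {R : realType}.
Notation mu := (@lebesgue_measure R).
Implicit Types (a b x t : R) (f g : R -> R).

(** The case of exponent 0, where the kernel is 1. *)
Lemma Fubini_triangle a b f g :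
  {within `[a, b], continuous f} -> {within `[a, b], continuous g} ->
  \int[mu]_(x in `[a, b]) (g x * \int[mu]_(t in `[a, x]) f t) =
  \int[mu]_(t in `[a, b]) (f t * \int[mu]_(x in `[t, b]) g x).
Proof.
move=> cf cg; have N10 : -1 < 0 :> R by rewrite ltrN10.
transitivity (\int[mu]_(x in `[a, b])
    (g x * \int[mu]_(t in `[a, x]) left_integrand 0 x f t)).
  apply: eq_Rintegral => x _; congr (_ * _); apply: eq_Rintegral => t _.
  by rewrite /left_integrand powRr0 mul1r.
rewrite (Fubini_kernel N10 cf cg); apply: eq_Rintegral => t _; congr (_ * _).
by apply: eq_Rintegral => x _; rewrite powRr0 mul1r.
Qed.

(** The substitution x = t + tau gives the range [a - tau, b - tau], whose part up to a is lost
    because g vanishes there. *)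
Lemma Rintegral_delay a b tau f g : 0 <= tau -> a <= b ->
  {within `[a, b], continuous f} -> continuous g -> (forall t, t <= a -> g t = 0) ->
  \int[mu]_(x in `[a, b]) (f x * g (x - tau)) =
  \int[mu]_(t in `[a, b - tau]) (f (t + tau) * g t).
Proof.
move=> tau0 ab cf cg g0.
rewrite Rintegral_mkcond -(@Rintegral_shift _ tau); last first.
  rewrite -restrict_EFin; apply/integrable_restrict => //; rewrite setTI.
  apply: within_itv_integrable; apply: within_continuousM => //.
  apply: continuous_within => x.
  apply: (@continuous_comp _ _ _ (fun x => x - tau) g); last exact: cg.
  by apply: (@continuousB _ _ _ id (cst tau)) => //; exact: cst_continuous.
rewrite [RHS]Rintegral_mkcond; apply: eq_Rintegral => t _.
rewrite !patchE !mem_setE !in_itv/= addrK.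
have [ta|at_] := leP t a; first by rewrite g0// !mulr0 !if_same.
rewrite (ltW at_)/= (_ : a <= t + tau); last by lra.
by rewrite lerBrDr.
Qed.

Lemma RintegralD_itv a b f g :
  {within `[a, b], continuous f} -> {within `[a, b], continuous g} ->
  \int[mu]_(x in `[a, b]) (f x + g x) =
  \int[mu]_(x in `[a, b]) f x + \int[mu]_(x in `[a, b]) g x.
Proof. by move=> cf cg; apply: RintegralD => //; exact: within_itv_integrable. Qed.

Lemma RintegralZl_itv a b k f : {within `[a, b], continuous f} ->
  \int[mu]_(x in `[a, b]) (k * f x) = k * \int[mu]_(x in `[a, b]) f x.
Proof. by move=> cf; apply: RintegralZl => //; exact: within_itv_integrable. Qed.

Lemma adjoint_left_kernel s a b k f g : -1 < s -> a <= b ->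
  {within `[a, b], continuous f} -> {within `[a, b], continuous g} ->
  \int[mu]_(x in `[a, b]) (g x * (k * \int[mu]_(t in `[a, x]) left_integrand s x f t)) =
  \int[mu]_(t in `[a, b]) (f t * (k * right_kernel_int s t b g t)).
Proof.
move=> s1 ab cf cg.
have cL := left_kernel_continuous s1 ab cf.
have cK := right_kernel_continuous s1 ab cg.
have -> : \int[mu]_(x in `[a, b])
    (g x * (k * \int[mu]_(t in `[a, x]) left_integrand s x f t)) =
  \int[mu]_(x in `[a, b]) (k * (g x * \int[mu]_(t in `[a, x]) left_integrand s x f t)).
  by apply: eq_Rintegral => x _; rewrite mulrCA.
rewrite (RintegralZl_itv _ (within_continuousM cg cL)) (Fubini_kernel s1 cf cg).
rewrite -(RintegralZl_itv _ (within_continuousM cf cK)).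
by apply: eq_Rintegral => x _; rewrite mulrCA.
Qed.

(** The adjoint is left as a right fractional integral of f tested against eta. The form with h and
    a right Riemann-Liouville derivative would require f to have such a derivative. *)
Lemma adjoint_caputo alpha a b eta f : 0 < alpha < 1 -> a < b ->
  continuous eta -> (forall t, t <= a -> eta t = 0) -> {within `[a, b], continuous f} ->
  \int[mu]_(x in `[a, b]) (f x * caputo alpha a (primitive a eta) x) =
  \int[mu]_(t in `[a, b])
    (eta t * ((Gamma (1 - alpha))^-1 * right_kernel_int (- alpha) t b f t)).
Proof.
move=> /andP[_ alpha1] ab ceta eta0 cf; rewrite /caputo (derive1_primitive ceta eta0).
apply: adjoint_left_kernel => //; [by lra|exact: ltW|exact: continuous_within].
Qed.

Lemma adjoint_left_frac_int beta a b f g : 0 < beta -> a < b ->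
  {within `[a, b], continuous f} -> {within `[a, b], continuous g} ->
  \int[mu]_(x in `[a, b]) (g x * left_frac_int beta a f x) =
  \int[mu]_(t in `[a, b]) (right_frac_int beta b g t * f t).
Proof.
move=> beta0 ab cf cg.
have b1 : -1 < beta - 1 by lra.
rewrite (adjoint_left_kernel (Gamma beta)^-1 b1 (ltW ab) cf cg).
by apply: eq_Rintegral => t _; rewrite mulrC.
Qed.

(** Exchanging the integrals in the memory term turns the past integral of m into the future
    integral Z of [Fz]; each partial of l thus joins the matching partial of L with weight Z. *)
Lemma swap_memory a b (F0 F1 F2 Fz m0 m1 m2 h Dh Ih Y V : R -> R) : a <= b ->
  {within `[a, b], continuous F0} -> {within `[a, b], continuous F1} ->
  {within `[a, b], continuous F2} -> {within `[a, b], continuous Fz} ->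
  {within `[a, b], continuous m0} -> {within `[a, b], continuous m1} ->
  {within `[a, b], continuous m2} ->
  {within `[a, b], continuous h} -> {within `[a, b], continuous Dh} ->
  {within `[a, b], continuous Ih} ->
  {within `[a, b], continuous Y} -> {within `[a, b], continuous V} ->
  let Z x := \int[mu]_(t in `[x, b]) Fz t in
  \int[mu]_(x in `[a, b])
    (F0 x * h x + F1 x * Dh x + F2 x * Ih x +
     Fz x * \int[mu]_(t in `[a, x]) (m0 t * h t + m1 t * Dh t + m2 t * Ih t) +
     Y x + V x) =
  \int[mu]_(x in `[a, b]) ((F0 x + Z x * m0 x) * h x) +
  \int[mu]_(x in `[a, b]) ((F1 x + Z x * m1 x) * Dh x) +
  \int[mu]_(x in `[a, b]) ((F2 x + Z x * m2 x) * Ih x) +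
  \int[mu]_(x in `[a, b]) Y x + \int[mu]_(x in `[a, b]) V x.
Proof.
move=> ab cF0 cF1 cF2 cFz cm0 cm1 cm2 ch cDh cIh cY cV Z.
have cZ : {within `[a, b], continuous Z} := Rintegral_right_continuous ab cFz.
pose m t := m0 t * h t + m1 t * Dh t + m2 t * Ih t.
have cm : {within `[a, b], continuous m} := within_continuousD_fun (within_continuousD_fun
  (within_continuousM cm0 ch) (within_continuousM cm1 cDh)) (within_continuousM cm2 cIh).
have cF : {within `[a, b], continuous (fun x => F0 x * h x + F1 x * Dh x + F2 x * Ih x)} :=
  within_continuousD_fun (within_continuousD_fun
  (within_continuousM cF0 ch) (within_continuousM cF1 cDh)) (within_continuousM cF2 cIh).
have cI : {within `[a, b], continuous (fun x => \int[mu]_(t in `[a, x]) m t)} :=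
  parameterized_integral_continuous ab (within_itv_integrable cm).
have c1 := within_continuousM cFz cI.
have c2 := within_continuousD_fun cF c1.
rewrite (RintegralD_itv (within_continuousD_fun c2 cY) cV) (RintegralD_itv c2 cY).
rewrite (RintegralD_itv cF c1) (Fubini_triangle cm cFz).
rewrite -(RintegralD_itv cF (within_continuousM cm cZ)).
have g0 := within_continuousM (within_continuousD_fun cF0 (within_continuousM cZ cm0)) ch.
have g1 := within_continuousM (within_continuousD_fun cF1 (within_continuousM cZ cm1)) cDh.
have g2 := within_continuousM (within_continuousD_fun cF2 (within_continuousM cZ cm2)) cIh.
rewrite -(RintegralD_itv g0 g1) -(RintegralD_itv (within_continuousD_fun g0 g1) g2).
congr (_ + _ + _); apply: eq_Rintegral => x _; rewrite /m -/(Z x); ring.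
Qed.

Context (alpha beta tau a b : R) (halpha : 0 < alpha < 1) (hbeta : 0 < beta)
  (htau : 0 < tau < b - a).
Context (Ly Lv Lw Lz Yt Vt ly lv lw : R -> R).
Context (cLy : {within `[a, b], continuous Ly}) (cLv : {within `[a, b], continuous Lv})
  (cLw : {within `[a, b], continuous Lw}) (cLz : {within `[a, b], continuous Lz})
  (cYt : {within `[a, b], continuous Yt}) (cVt : {within `[a, b], continuous Vt})
  (cly : {within `[a, b], continuous ly}) (clv : {within `[a, b], continuous lv})
  (clw : {within `[a, b], continuous lw}).

Let tau0 : 0 < tau. Proof. by case/andP: htau. Qed.
Let ab : a < b. Proof. by case/andP: htau; lra. Qed.
Let abW : a <= b. Proof. exact: ltW. Qed.
Let alphaN1 : -1 < - alpha. Proof. by case/andP: halpha; lra. Qed.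
Let betaN1 : -1 < beta - 1. Proof. by have := hbeta; lra. Qed.

Let Z x := \int[mu]_(t in `[x, b]) Lz t.
(** [A0], [A1] and [A2] are the y, v and w partials of L + Z l. *)
Let A0 x := Ly x + Z x * ly x.
Let A1 x := Lv x + Z x * lv x.
Let A2 x := Lw x + Z x * lw x.
(** The factor of h without delay, once the fractional integral has been moved off it. As h is a
    primitive of eta, it reaches the factor [B] of eta through one more integration over [x, b]. *)
Let G x := A0 x + right_frac_int beta b A2 x.
Let B x := (Gamma (1 - alpha))^-1 * right_kernel_int (- alpha) x b A1 x
  + \int[mu]_(t in `[x, b]) G t.
(** The delayed terms, pulled back by tau to [a, b - tau]: the factor [Yt] of h is integrated once,
    the factor [Vt] of eta is not. *)
Let E x := \int[mu]_(t in `[x, b - tau]) Yt (t + tau) + Vt (x + tau).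

Let cZ : {within `[a, b], continuous Z}.
Proof. exact: Rintegral_right_continuous. Qed.

Let cD f g : {within `[a, b], continuous f} -> {within `[a, b], continuous g} ->
  {within `[a, b], continuous (fun x => f x + g x)}.
Proof. exact: within_continuousD. Qed.

Let cA f g : {within `[a, b], continuous f} -> {within `[a, b], continuous g} ->
  {within `[a, b], continuous (fun x => f x + Z x * g x)}.
Proof. by move=> cf cg; apply: cD => //; exact: within_continuousM. Qed.

Let cR s f : -1 < s -> {within `[a, b], continuous f} ->
  forall k, {within `[a, b], continuous (fun x => k * right_kernel_int s x b f x)}.
Proof.
move=> s1 cf k; apply: within_continuousM; first exact: within_continuous_cst.
exact: right_kernel_continuous.
Qed.

Let cG : {within `[a, b], continuous G}.
Proof. by apply: cD; [exact: cA|apply: cR => //; exact: cA]. Qed.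

Let cB : {within `[a, b], continuous B}.
Proof.
by apply: cD; [apply: cR => //; exact: cA|exact: Rintegral_right_continuous].
Qed.

Let shiftc f : {within `[a, b], continuous f} ->
  {within `[a, b - tau], continuous (fun x => f (x + tau))}.
Proof.
move=> cf; apply: (within_itv_sub _ _ (within_itv_shift (c := tau) cf)) => //.
by have := tau0; lra.
Qed.

Let cE : {within `[a, b - tau], continuous E}.
Proof.
apply: (@within_continuousD _ _ _ _ (fun x => \int[mu]_(t in `[x, b - tau]) Yt (t + tau))
  (fun x => Vt (x + tau))); last exact: shiftc.
by apply: Rintegral_right_continuous; [case/andP: htau; lra|exact: shiftc].
Qed.

Lemma weak_form eta : continuous eta -> (forall t, t <= a -> eta t = 0) ->
  let h := primitive a eta in
  let Dh := caputo alpha a h in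
  let Ih := left_frac_int beta a h in
  \int[mu]_(x in `[a, b])
    (Ly x * h x + Lv x * Dh x + Lw x * Ih x +
     Lz x * \int[mu]_(t in `[a, x]) (ly t * h t + lv t * Dh t + lw t * Ih t) +
     Yt x * h (x - tau) + Vt x * eta (x - tau)) =
  \int[mu]_(t in `[a, b]) (eta t * B t) + \int[mu]_(t in `[a, b - tau]) (eta t * E t).
Proof.
have rearrange (p q r s t : R) : p + q + r + s + t = q + (p + r) + (s + t) by ring.
move=> ceta eta0 h Dh Ih.
have chR : continuous h by exact: continuous_primitive.
have ch : {within `[a, b], continuous h} by exact: continuous_within.
have ce : {within `[a, b], continuous eta} by exact: continuous_within.
have ce' : {within `[a, b - tau], continuous eta} by exact: continuous_within.
have cDh : {within `[a, b], continuous Dh}.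
  exact: (within_caputo_primitive halpha htau ceta eta0).
have cIh : {within `[a, b], continuous Ih}.
  exact: (within_left_frac_int_primitive hbeta htau ceta eta0).
have cA0 : {within `[a, b], continuous A0} := cA cLy cly.
have cA1 : {within `[a, b], continuous A1} := cA cLv clv.
have cA2 : {within `[a, b], continuous A2} := cA cLw clw.
pose R1 x := (Gamma (1 - alpha))^-1 * right_kernel_int (- alpha) x b A1 x.
have cR1 : {within `[a, b], continuous R1} := @cR _ _ alphaN1 cA1 _.
have cR2 : {within `[a, b], continuous (right_frac_int beta b A2)} := @cR _ _ betaN1 cA2 _.
have cIG : {within `[a, b], continuous (fun x => \int[mu]_(t in `[x, b]) G t)}.
  exact: (Rintegral_right_continuous abW cG).
have cYt' := shiftc cYt; have cVt' := shiftc cVt.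
have am : a <= b - tau by case/andP: htau; lra.
have cIY : {within `[a, b - tau], continuous
    (fun x => \int[mu]_(t in `[x, b - tau]) Yt (t + tau))}.
  exact: (Rintegral_right_continuous am cYt').
have H1 : \int[mu]_(x in `[a, b]) (A1 x * Dh x) = \int[mu]_(t in `[a, b]) (eta t * R1 t).
  exact: (adjoint_caputo halpha ab ceta eta0 cA1).
have H2 : \int[mu]_(x in `[a, b]) (A2 x * Ih x) =
    \int[mu]_(t in `[a, b]) (right_frac_int beta b A2 t * h t).
  exact: (adjoint_left_frac_int hbeta ab ch cA2).
have H3 : \int[mu]_(x in `[a, b]) (G x * h x) =
    \int[mu]_(x in `[a, b]) (eta x * \int[mu]_(t in `[x, b]) G t).
  exact: (Fubini_triangle ce cG).
have H4 : \int[mu]_(x in `[a, b]) (Yt x * h (x - tau)) =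
    \int[mu]_(x in `[a, b - tau]) (eta x * \int[mu]_(t in `[x, b - tau]) Yt (t + tau)).
  rewrite (Rintegral_delay (ltW tau0) abW cYt chR); last first.
    by move=> t ta; exact: (primitive_le eta0 ta).
  exact: (Fubini_triangle ce' cYt').
have H5 := Rintegral_delay (ltW tau0) abW cVt ceta eta0.
have cYh : {within `[a, b], continuous (fun x => Yt x * h (x - tau))} :=
  within_continuousM cYt (@within_continuous_delay _ a b tau _ chR).
have cVe : {within `[a, b], continuous (fun x => Vt x * eta (x - tau))} :=
  within_continuousM cVt (@within_continuous_delay _ a b tau _ ceta).
rewrite (swap_memory abW cLy cLv cLw cLz cly clv clw ch cDh cIh cYh cVe).
rewrite H1 H2 H4 H5.
rewrite (_ : \int[mu]_(t in `[a, b]) (eta t * B t) =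
    \int[mu]_(t in `[a, b]) (eta t * R1 t) + \int[mu]_(x in `[a, b]) (G x * h x)); last first.
  rewrite H3 -(RintegralD_itv (within_continuousM ce cR1) (within_continuousM ce cIG)).
  by apply: eq_Rintegral => x _; rewrite /B mulrDr.
rewrite (_ : \int[mu]_(t in `[a, b]) (G t * h t) =
    \int[mu]_(t in `[a, b]) (A0 t * h t) +
    \int[mu]_(t in `[a, b]) (right_frac_int beta b A2 t * h t)); last first.
  rewrite -(RintegralD_itv (within_continuousM cA0 ch) (within_continuousM cR2 ch)).
  by apply: eq_Rintegral => x _; rewrite /G mulrDl.
rewrite (_ : \int[mu]_(t in `[a, b - tau]) (eta t * E t) =
    \int[mu]_(x in `[a, b - tau]) (eta x * \int[mu]_(t in `[x, b - tau]) Yt (t + tau))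
    + \int[mu]_(x in `[a, b - tau]) (Vt (x + tau) * eta x)); last first.
  rewrite -(RintegralD_itv (within_continuousM ce' cIY) (within_continuousM cVt' ce')).
  by apply: eq_Rintegral => x _; rewrite /E mulrDr [X in _ = _ + X]mulrC.
exact: rearrange.
Qed.

Hypothesis stationary : forall eta, continuous eta -> (forall t, t <= a -> eta t = 0) ->
  primitive a eta b = 0 ->
  let h := primitive a eta in
  let Dh := caputo alpha a h in
  let Ih := left_frac_int beta a h in
  \int[mu]_(x in `[a, b])
    (Ly x * h x + Lv x * Dh x + Lw x * Ih x +
     Lz x * \int[mu]_(t in `[a, x]) (ly t * h t + lv t * Dh t + lw t * Ih t) +
     Yt x * h (x - tau) + Vt x * eta (x - tau)) = 0.

(** Stationarity is available only for eta of integral 0, that is h b = 0, so the integrated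
    equations hold up to a constant. *)
Let integrated : exists c, (forall x, a <= x <= b - tau -> B x + E x = c) /\
  (forall x, b - tau <= x <= b -> B x = c).
Proof.
apply: du_bois_reymond => //; [by case/andP: htau; lra|by have := tau0; lra|].
by move=> eta ceta eta0 hb; rewrite -weak_form//; exact: stationary.
Qed.

Lemma transversality : Vt b = 0.
Proof.
have [c [H1 H2]] := integrated.
have am : a <= b - tau <= b - tau by rewrite lexx andbT; case/andP: htau; lra.
have mb : b - tau <= b - tau <= b by rewrite lexx/=; have := tau0; lra.
have : E (b - tau) = 0.
  by apply: (addrI (B (b - tau))); rewrite addr0 (H1 _ am) (H2 _ mb).
(* At b - tau the integral in [E] runs over a single point. *)
by rewrite /E set_itv1 Rintegral_set1 add0r subrK.
Qed.

Let Zlv x := Z x * lv x.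
Let Zlw x := Z x * lw x.

Let cZlv : {within `[a, b], continuous Zlv}. Proof. exact: within_continuousM. Qed.
Let cZlw : {within `[a, b], continuous Zlw}. Proof. exact: within_continuousM. Qed.

Let right_kernelD s x f g : -1 < s -> a <= x <= b ->
  {within `[a, b], continuous f} -> {within `[a, b], continuous g} ->
  right_kernel_int s x b (fun t => f t + g t) x =
  right_kernel_int s x b f x + right_kernel_int s x b g x.
Proof.
move=> s1 xab cf cg; rewrite /right_kernel_int -RintegralD//; last 2 first.
- exact: (right_kernel_integrable s1 xab cf).
- exact: (right_kernel_integrable s1 xab cg).
by apply: eq_Rintegral => t _; rewrite mulrDr.
Qed.

(** With c = b - tau this separates the operator with endpoint b - tau from an integral over the
    fixed range [b - tau, b], as in the equation on [a, b - tau]. *)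
Let right_kernel_split s x c f : -1 < s -> a <= x <= c -> c <= b ->
  {within `[a, b], continuous f} ->
  right_kernel_int s x b f x = right_kernel_int s x c f x + right_kernel_int s c b f x.
Proof.
move=> s1 /andP[ax xc] cb cf; apply: Rintegral_itv_split; first by rewrite xc.
by apply: (right_kernel_integrable s1 _ cf); rewrite ax (le_trans xc).
Qed.

Let is_deriv_on_G (S : set R) x : S `<=` `[a, b] -> a <= x <= b ->
  is_deriv_on S (fun u => \int[mu]_(t in `[u, b]) G t) x (- G x).
Proof.
move=> Sab xab; apply: (is_deriv_on_subset Sab).
exact: is_deriv_on_Rintegral_right.
Qed.

(** [B] is constant on S, so its derivative along S is 0. The same derivative is computed term by
    term, from the hypotheses for the two kernel integrals and from the fundamental theorem of
    calculus for the integral of [G]; the equation is its negative. *)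
Lemma euler_lagrange_right x : let S := `[b - tau, b]%classic in b - tau <= x <= b ->
  right_RL_derivable S alpha b Lv x -> right_RL_derivable S alpha b Zlv x ->
  Ly x + right_RL S alpha b Lv x + right_frac_int beta b Lw x + Z x * ly x
  + right_RL S alpha b Zlv x + right_frac_int beta b Zlw x = 0.
Proof.
have alg (k1 k2 d1 d2 p q K1 K2 : R) :
    0 = k1 * (d1 + d2) + - (p + q + k2 * (K1 + K2)) ->
    p + - k1 * d1 + k2 * K1 + q + - k1 * d2 + k2 * K2 = 0 by move=> ?; lra.
move=> S xS dLv dlv; have [c [_ H]] := integrated.
have am : a < b - tau by case/andP: htau; lra.
have mb : b - tau < b by have := tau0; lra.
have Sab : S `<=` `[a, b] by apply: subset_itvr; rewrite bnd_simp; exact: ltW.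
have Sx : S x by rewrite /S /= in_itv.
have sab u : u \in S -> a <= u <= b by rewrite inE => /Sab; rewrite /= in_itv.
have xab : a <= x <= b by apply: sab; rewrite inE.
have PF : ProperFilter (within S x^') by exact: within_itv_dnbhs_proper.
have D1 := is_deriv_onD (is_deriv_onZ (k := (Gamma (1 - alpha))^-1) (is_deriv_onD
  (is_deriv_on_deriv dLv) (is_deriv_on_deriv dlv))) (is_deriv_on_G Sab xab).
have D0 := is_deriv_on_cst S c x.
have {}D0 := is_deriv_on_eq Sx _ D0.
have := is_deriv_on_val PF D1.
rewrite (is_deriv_on_val PF (D0 _ _)); last first.
  move=> u uS; have uS' := uS; move: uS'; rewrite inE /S /= in_itv/= => /H <-.
  by rewrite /B right_kernelD//; exact: sab.
rewrite /right_RL /G /A0 /right_frac_int right_kernelD//.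
exact: alg.
Qed.

(** The same comparison for [B] + [E]. The delayed part contributes - Yt (x + tau) by the
    fundamental theorem of calculus and the assumed derivative of the shifted [Vt]; each kernel
    integral is split at b - tau before differentiating. *)
Lemma euler_lagrange_left x : let S := `[a, b - tau]%classic in a <= x <= b - tau ->
  right_RL_derivable S alpha (b - tau) Lv x ->
  derivable_on S (right_kernel_int (- alpha) (b - tau) b Lv) x ->
  right_RL_derivable S alpha (b - tau) Zlv x ->
  derivable_on S (right_kernel_int (- alpha) (b - tau) b Zlv) x ->
  derivable_on S (fun u => Vt (u + tau)) x ->
  Ly x
  + right_RL S alpha (b - tau) Lv x
  - (Gamma (1 - alpha))^-1 *
      deriv_on S (right_kernel_int (- alpha) (b - tau) b Lv) x
  + right_frac_int beta (b - tau) Lw x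
  + (Gamma beta)^-1 * right_kernel_int (beta - 1) (b - tau) b Lw x
  + Z x * ly x
  + right_RL S alpha (b - tau) Zlv x
  - (Gamma (1 - alpha))^-1 *
      deriv_on S (right_kernel_int (- alpha) (b - tau) b Zlv) x
  + right_frac_int beta (b - tau) Zlw x
  + (Gamma beta)^-1 * right_kernel_int (beta - 1) (b - tau) b Zlw x
  + Yt (x + tau)
  - deriv_on S (fun u => Vt (u + tau)) x = 0.
Proof.
have alg (k1 k2 d1 d1' d2 d2' p q K1 K1' K2 K2' Y dY : R) :
    0 = k1 * (d1 + d1' + (d2 + d2')) + - (p + q + k2 * (K1 + K1' + (K2 + K2')))
      + (- Y + dY) ->
    p + - k1 * d1 - k1 * d1' + k2 * K1 + k2 * K1' + q + - k1 * d2 - k1 * d2'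
      + k2 * K2 + k2 * K2' + Y - dY = 0 by move=> ?; lra.
move=> S xS dLv dLv' dlv dlv' dV; have [c [H _]] := integrated.
have am : a < b - tau by case/andP: htau; lra.
have mb : b - tau <= b by have := tau0; lra.
have Sab : S `<=` `[a, b] by apply: subset_itvl; rewrite bnd_simp.
have Sx : S x by rewrite /S /= in_itv.
have sab u : u \in S -> a <= u <= b by rewrite inE => /Sab; rewrite /= in_itv.
have xab : a <= x <= b by apply: sab; rewrite inE.
have PF : ProperFilter (within S x^') by exact: within_itv_dnbhs_proper.
have D1 := is_deriv_onD (is_deriv_onZ (k := (Gamma (1 - alpha))^-1) (is_deriv_onD
  (is_deriv_onD (is_deriv_on_deriv dLv) (is_deriv_on_deriv dLv'))
  (is_deriv_onD (is_deriv_on_deriv dlv) (is_deriv_on_deriv dlv')))) (is_deriv_on_G Sab xab).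
have D2 := is_deriv_onD (is_deriv_on_Rintegral_right (shiftc cYt) xS) (is_deriv_on_deriv dV).
have D0 := is_deriv_on_eq Sx _ (is_deriv_on_cst S c x).
have := is_deriv_on_val PF (is_deriv_onD D1 D2).
rewrite (is_deriv_on_val PF (D0 _ _)); last first.
  move=> u uS; have uS' := uS; move: uS'; rewrite inE /S /= in_itv/= => uS'.
  rewrite -(H _ uS') /B /E right_kernelD//; last exact: sab.
  rewrite (right_kernel_split alphaN1 uS' mb cLv).
  by rewrite (right_kernel_split alphaN1 uS' mb cZlv).
rewrite /right_RL /G /A0 /right_frac_int right_kernelD//.
rewrite (right_kernel_split betaN1 xS mb cLw) (right_kernel_split betaN1 xS mb cZlw).
exact: alg.
Qed.

End adjoint.

Theorem theorem3 (R : realType) (alpha beta tau a b : R)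
    (phi : R -> R) (yb : R)
    (L : 'rV[R]_7 -> R) (l : 'rV[R]_4 -> R) (y : R -> R)
    (halpha : 0 < alpha < 1) (hbeta : 0 < beta) (htau : 0 < tau < b - a)
    (hL : C1_on (slab a b) L) (hl : C1_on (slab a b) l)
    (hy : admissible alpha beta tau a b phi yb y)
    (hext :
      (forall y1, admissible alpha beta tau a b phi yb y1 ->
         J alpha beta tau a b L l y <= J alpha beta tau a b L l y1) \/
      (forall y1, admissible alpha beta tau a b phi yb y1 ->
         J alpha beta tau a b L l y1 <= J alpha beta tau a b L l y)) :
  let dL i x := partial (slab a b) i L (bracket alpha beta tau a b l y x) in
  let dl i x := partial (slab a b) i l (curly alpha beta a y x) in
  let Z x := \int[@lebesgue_measure R]_(t in `[x, b]) dL arg_z t in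
  let Zdl i x := Z x * dl i x in
  let S1 := [set` `[a, b - tau]] : set R in
  let S2 := [set` `[b - tau, b]] : set R in
  [/\ dL arg_vtau b = 0,
      (forall x, a <= x <= b - tau ->
         right_RL_derivable S1 alpha (b - tau) (dL arg_v) x ->
         derivable_on S1 (right_kernel_int (- alpha) (b - tau) b (dL arg_v)) x ->
         right_RL_derivable S1 alpha (b - tau) (Zdl arg_v) x ->
         derivable_on S1 (right_kernel_int (- alpha) (b - tau) b (Zdl arg_v)) x ->
         derivable_on S1 (fun u => dL arg_vtau (u + tau)) x ->
         dL arg_y x
         + right_RL S1 alpha (b - tau) (dL arg_v) x
         - (Gamma (1 - alpha))^-1 *
             deriv_on S1 (right_kernel_int (- alpha) (b - tau) b (dL arg_v)) x
         + right_frac_int beta (b - tau) (dL arg_w) x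
         + (Gamma beta)^-1 *
             right_kernel_int (beta - 1) (b - tau) b (dL arg_w) x
         + Z x * dl arg_y x
         + right_RL S1 alpha (b - tau) (Zdl arg_v) x
         - (Gamma (1 - alpha))^-1 *
             deriv_on S1 (right_kernel_int (- alpha) (b - tau) b (Zdl arg_v)) x
         + right_frac_int beta (b - tau) (Zdl arg_w) x
         + (Gamma beta)^-1 *
             right_kernel_int (beta - 1) (b - tau) b (Zdl arg_w) x
         + dL arg_ytau (x + tau)
         - deriv_on S1 (fun u => dL arg_vtau (u + tau)) x = 0)
    & (forall x, b - tau <= x <= b ->
         right_RL_derivable S2 alpha b (dL arg_v) x ->
         right_RL_derivable S2 alpha b (Zdl arg_v) x ->
         dL arg_y x
         + right_RL S2 alpha b (dL arg_v) x
         + right_frac_int beta b (dL arg_w) x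
         + Z x * dl arg_y x
         + right_RL S2 alpha b (Zdl arg_v) x
         + right_frac_int beta b (Zdl arg_w) x = 0)].
Proof.
move=> dL dl Z Zdl S1 S2.
have cdL i : {within `[a, b], continuous (dL i)}.
  exact: (within_continuous_partial_bracket htau hy hL hl).
have cdl i : {within `[a, b], continuous (dl i)}.
  exact: (within_continuous_partial_curly htau hy hl).
have stat (eta : R -> R) : continuous eta -> (forall t, t <= a -> eta t = 0) ->
    primitive a eta b = 0 ->
    let h := primitive a eta in
    let Dh := caputo alpha a h in
    let Ih := left_frac_int beta a h in
    \int[@lebesgue_measure R]_(x in `[a, b])
      (dL arg_y x * h x + dL arg_v x * Dh x + dL arg_w x * Ih x +
       dL arg_z x * \int[@lebesgue_measure R]_(t in `[a, x])
         (dl arg_y t * h t + dl arg_v t * Dh t + dl arg_w t * Ih t) +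
       dL arg_ytau x * h (x - tau) + dL arg_vtau x * eta (x - tau)) = 0.
  move=> ceta eta0 hb h Dh Ih.
  rewrite -[RHS](first_variation halpha hbeta htau ceta eta0 hy hL hl hb hext).
  apply: eq_Rintegral => x _; rewrite sum_ord7.
  have <- : \int[@lebesgue_measure R]_(t in `[a, x])
      (dl arg_y t * h t + dl arg_v t * Dh t + dl arg_w t * Ih t) =
    dbracket alpha beta tau a b eta y l arg_z x.
    by apply: eq_Rintegral => t _; rewrite sum_ord4.
  by [].
split.
- exact: (transversality halpha hbeta htau (cdL _) (cdL _) (cdL _) (cdL _) (cdL _) (cdL _)
    (cdl _) (cdl _) (cdl _) stat).
- move=> x; exact: (euler_lagrange_left halpha hbeta htau (cdL _) (cdL _) (cdL _)
    (cdL _) (cdL _) (cdL _) (cdl _) (cdl _) (cdl _) stat).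
- move=> x; exact: (euler_lagrange_right halpha hbeta htau (cdL _) (cdL _) (cdL _)
    (cdL _) (cdL _) (cdL _) (cdl _) (cdl _) (cdl _) stat).
Qed.
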